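(* Let $G$ be a contact Carnot group. There exist constants $R_1',C_1'$ such that for every $p=(x,z)\in G$ with $p\ne p_0$: $$C_1'\frac{|z|}{\|x\|^2}+R_1'\le\hat\beta(p).$$ In particular, one can take $$C_1'=\frac8\pi\frac{\alpha_1}{\alpha_k^2}\sin\left(\frac{\delta'\pi}{2}\right)^2\quad\text{with}\quad\delta'=\left(\sum_{j\notin I_0}\frac{\alpha_1}{\alpha_j}\left\lfloor\frac{\alpha_j}{\alpha_1}\right\rfloor\right)^{-1},\qquad I_0=\{j\mid x_j=0\},$$ where $\alpha_1<\dots<\alpha_k$ are the distinct singular values of $A$. Moreover, $R_1'$ (resp. $C_1'$) is homogeneous of degree $0$ (resp. $-1$) as a function of the singular values $\alpha_1,\dots,\alpha_k$. (When $x=0$ the left-hand side is understood as $+\infty$.)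
   Context: A contact Carnot group $G$ is a connected, simply connected Lie group of dimension $2n+1$ whose Lie algebra of left-invariant vector fields splits as $\mathfrak g=\mathfrak g_1\oplus\mathfrak g_2$ with $\dim\mathfrak g_2=1$, $[\mathfrak g_1,\mathfrak g_1]=\mathfrak g_2$, $[\mathfrak g_1,\mathfrak g_2]=[\mathfrak g_2,\mathfrak g_2]=0$, with a scalar product on $\mathfrak g_1$ having orthonormal basis $f_1,\dots,f_{2n}$. Fix a generator $f_0$ of $\mathfrak g_2$; then $[f_i,f_j]=A_{ij}f_0$ for a skew-symmetric non-degenerate matrix $A$. Exponential coordinates: $p=(x,z)\in\mathbb{R}^{2n}\times\mathbb{R}$ means $p=\exp_G(\sum_i x_if_i+zf_0)$; $p_0=(0,0)$. Let $0<\alpha_1<\dots<\alpha_k$ be the distinct singular values of $A$ and $x_j\in\mathbb{R}^{2n_j}$ the projection of $x$ on the ($2n_j$-dimensional) invariant subspace associated with $\alpha_j$. A geodesic is a non-constant Lipschitz curve $\gamma:[0,1]\to G$, tangent a.e. to $\mathfrak g_1$, locally minimizing the energy $\frac12\int_0^1\|\dot\gamma\|^2dt$. With $H(\eta)=\frac12\sum_i\langle\eta,f_i\rangle^2$ on $T^*G$, the exponential map is $\hat E(\eta)=\pi(e^{\vec H}(\eta))$, $\eta\in T_{p_0}^*G$, and $\Gamma(p)=\hat E^{-1}(p)\subset T^*_{p_0}G$ with the subspace topology is the set of geodesics from $p_0$ to $p$, each identified with its initial covector. $\hat\beta(p)=\sum_i\operatorname{rank}H_i(\Gamma(p);\mathbb{Z})\in\mathbb{N}\cup\{\infty\}$.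 The explicit value of $C_1'$ depends on $p$ only through the index set $I_0$. *)

(* Defs.v *)
From HB Require Import structures.
From mathcomp Require Import all_boot all_order all_algebra.
From mathcomp Require Import all_classical all_reals all_analysis.

Set Implicit Arguments.
Unset Strict Implicit.
Unset Printing Implicit Defensive.

Import Order.TTheory GRing.Theory Num.Theory numFieldNormedType.Exports.

Local Open Scope classical_set_scope.
Local Open Scope ring_scope.

(** * Singular homology *)

Definition std_simplex (R : realType) (k : nat) : set 'rV[R]_k.+1 :=
  [set t | (forall i, 0 <= t ord0 i) /\ \sum_i t ord0 i = 1].
Arguments std_simplex : clear implicits.

(* The i-th face inclusion inserts a zero barycentric coordinate at i. *)
Definition face_row (R : realType) (k : nat) (i : 'I_k.+2) (t : 'rV[R]_k.+1) :
    'rV[R]_k.+2 :=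
  \row_j (if unlift i j is Some l then t ord0 l else 0).

Lemma face_row_simplex (R : realType) (k : nat) (i : 'I_k.+2)
    (t : std_simplex R k) :
  face_row i (\val t) \in std_simplex R k.+1.
Proof.
case: t => t /set_mem [t0 t1] /=; apply/mem_set; split.
  by move=> j; rewrite mxE; case: (unlift i j).
rewrite (bigD1_ord i) //= mxE unlift_none add0r -[RHS]t1.
by apply: eq_bigr => j _; rewrite mxE liftK.
Qed.

Definition face_map (R : realType) (k : nat) (i : 'I_k.+2)
    (t : std_simplex R k) : std_simplex R k.+1 :=
  exist _ (face_row i (\val t)) (face_row_simplex i t).

Lemma face_row_continuous (R : realType) (k : nat) (i : 'I_k.+2) :
  continuous (@face_row R k i).
Proof.
move=> t /= U /(nbhs_ballP (face_row i t)) [e e0 eU].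
apply/nbhs_ballP; exists e => //= s ts; apply: eU.
case: ts => _ ts; split => // a b; rewrite !mxE.
by case: (unlift i b) => [l|]; [exact: ts | exact: ballxx].
Qed.

Lemma face_map_continuous (R : realType) (k : nat) (i : 'I_k.+2) :
  continuous (@face_map R k i).
Proof.
apply: (@continuous_comp_initial _ (std_simplex R k) _ set_val).
have -> : set_val \o @face_map R k i = @face_row R k i \o set_val by [].
move=> t; apply: continuous_comp; last exact: face_row_continuous.
exact: initial_continuous.
Qed.

(* Singular simplices have the simplex itself as domain, so that equality of
   functions is equality of singular simplices. *)
Definition sing (R : realType) (T : topologicalType) (k : nat) : choiceType :=
  set_type [set f : std_simplex R k -> T | continuous f].

Lemma face_continuous (R : realType) (T : topologicalType) (k : nat)
    (i : 'I_k.+2) (s : sing R T k.+1) :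
  (\val s \o face_map i) \in
    [set f : std_simplex R k -> T | continuous f].
Proof.
have cs : continuous (\val s) by exact: (set_mem (valP s)).
apply/mem_set => t /=.
by apply: continuous_comp; [exact: face_map_continuous | exact: cs].
Qed.

Definition face (R : realType) (T : topologicalType) (k : nat) (i : 'I_k.+2)
    (s : sing R T k.+1) : sing R T k :=
  exist _ (\val s \o face_map i) (face_continuous i s).

(* A singular chain is given by its coefficients. *)
Definition is_chain (R : realType) (T : topologicalType) (k : nat)
    (c : sing R T k -> int) : Prop :=
  finite_set [set s | c s != 0].

Definition boundary (R : realType) (T : topologicalType) (k : nat)
    (c : sing R T k.+1 -> int) (s : sing R T k) : int :=
  \sum_(i < k.+2) (-1) ^+ i * \sum_(u \in [set u | face i u = s]) c u.

Definition is_cycle (R : realType) (T : topologicalType) (k : nat) :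
    (sing R T k -> int) -> Prop :=
  match k with
  | 0 => fun c => is_chain c
  | k'.+1 => fun c => is_chain c /\ forall s, boundary c s = 0
  end.

Definition is_boundary (R : realType) (T : topologicalType) (k : nat)
    (c : sing R T k -> int) : Prop :=
  exists2 d : sing R T k.+1 -> int, is_chain d & forall s, c s = boundary d s.

(* The rank of H_k(T; Z): the supremum of the sizes of families of cycles whose
   homology classes are linearly independent over Z. *)
Definition homology_rank (R : realType) (T : topologicalType) (k : nat) :
    \bar R :=
  ereal_sup [set m%:R%:E | m in [set m : nat |
    exists c : 'I_m -> sing R T k -> int,
      (forall i, is_cycle (c i)) /\
      (forall a : 'I_m -> int,
        is_boundary (fun s => \sum_i a i * c i s) -> forall i, a i = 0)]].

Definition total_betti (R : realType) (T : topologicalType) : \bar R :=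
  (\sum_(0 <= k <oo) homology_rank R T k)%E.

(** * Contact Carnot groups *)

(* The Lie algebra of a contact Carnot group of dimension 2n+1, with an
   orthonormal frame f_i (i < 2n) of g_1 and a generator f_0 of g_2. A connected
   and simply connected nilpotent Lie group is determined by its Lie algebra
   through its (bijective) exponential map; see [cc_mul] below for the group. *)
Record contact_carnot (R : realType) (n : nat) := ContactCarnot {
  cc_lie : vectType R ;
  cc_br : cc_lie -> cc_lie -> cc_lie ;
  cc_g1 : {vspace cc_lie} ;
  cc_g2 : {vspace cc_lie} ;
  cc_dot : cc_lie -> cc_lie -> R ;
  cc_f : 'I_(n.*2) -> cc_lie ;
  cc_f0 : cc_lie ;
  cc_A : 'M[R]_(n.*2) ;
  cc_br_linl : forall a u v w,
    cc_br (a *: u + v) w = a *: cc_br u w + cc_br v w ;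
  cc_br_linr : forall a u v w,
    cc_br u (a *: v + w) = a *: cc_br u v + cc_br u w ;
  cc_br_alt : forall u, cc_br u u = 0 ;
  cc_br_jacobi : forall u v w,
    cc_br u (cc_br v w) + cc_br v (cc_br w u) + cc_br w (cc_br u v) = 0 ;
  cc_sum : (cc_g1 + cc_g2)%VS = fullv ;
  cc_direct : (cc_g1 :&: cc_g2)%VS = 0%VS ;
  cc_dim1 : \dim cc_g1 = n.*2 ;
  cc_dim2 : \dim cc_g2 = 1%N ;
  cc_br11 :
    (<<[seq cc_br u v | u <- vbasis cc_g1, v <- vbasis cc_g1]>>)%VS = cc_g2 ;
  cc_br12 : {in cc_g1 & cc_g2, forall u v, cc_br u v = 0} ;
  cc_br22 : {in cc_g2 & cc_g2, forall u v, cc_br u v = 0} ;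
  (* scalar product on g_1 *)
  cc_dot_lin : {in cc_g1 & &, forall u v w, forall a,
    cc_dot (a *: u + v) w = a * cc_dot u w + cc_dot v w} ;
  cc_dot_sym : {in cc_g1 &, forall u v, cc_dot u v = cc_dot v u} ;
  cc_dot_pos : {in cc_g1, forall u, u != 0 -> 0 < cc_dot u u} ;
  cc_f_basis : basis_of cc_g1 [seq cc_f i | i <- enum 'I_(n.*2)] ;
  cc_f_orth : forall i j, cc_dot (cc_f i) (cc_f j) = (i == j)%:R ;
  cc_f0_gen : (<[cc_f0]>)%VS = cc_g2 ;
  cc_AE : forall i j, cc_br (cc_f i) (cc_f j) = cc_A i j *: cc_f0 ;
  cc_contact : cc_A \in unitmx
}.

(* Exponential coordinates (x, z), also used for tangent vectors and covectors
   (in the dual coordinates). The point p_0 is 0. *)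
Notation ccpt R n := ('rV[R]_(n.*2) * R)%type.

Definition cc_log (R : realType) (n : nat) (G : contact_carnot R n)
    (p : ccpt R n) : cc_lie G :=
  \sum_i p.1 ord0 i *: cc_f G i + p.2 *: cc_f0 G.

(* The group law in exponential coordinates, by the Baker-Campbell-Hausdorff
   formula exp(u) exp(v) = exp(u + v + [u, v] / 2) (see [cc_mul_BCH]). *)
Definition cc_mul (R : realType) (n : nat) (G : contact_carnot R n)
    (p q : ccpt R n) : ccpt R n :=
  (p.1 + q.1, p.2 + q.2 + 2^-1 * (p.1 *m cc_A G *m q.1^T) ord0 ord0).

(* The left-invariant vector field whose value at p_0 is v: it generates right
   translations by the one-parameter subgroup s |-> exp(s v). *)
Definition linv_field (R : realType) (n : nat) (G : contact_carnot R n)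
    (v : ccpt R n) (p : ccpt R n) : ccpt R n :=
  derive1 (fun s : R => cc_mul G p (s *: v)) 0.

Definition cc_field (R : realType) (n : nat) (G : contact_carnot R n)
    (i : 'I_(n.*2)) : ccpt R n -> ccpt R n :=
  linv_field G (delta_mx ord0 i, 0).

Definition pairing (R : realType) (n : nat) (xi v : ccpt R n) : R :=
  \sum_i xi.1 ord0 i * v.1 ord0 i + xi.2 * v.2.

Definition hamiltonian (R : realType) (n : nat) (G : contact_carnot R n)
    (q xi : ccpt R n) : R :=
  2^-1 * \sum_(i < n.*2) pairing xi (cc_field G i q) ^+ 2.

(* Integral curves t |-> (q(t), xi(t)) of the Hamiltonian vector field on T^*G:
   q' = dH/dxi and xi' = - dH/dq in canonical coordinates, tested against
   arbitrary covectors zeta and vectors v. *)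
Definition hamiltonian_curve (R : realType) (n : nat) (G : contact_carnot R n)
    (lam : R -> ccpt R n * ccpt R n) : Prop :=
  forall t : R,
    (forall zeta : ccpt R n,
      is_derive t (1 : R) (fun s => pairing zeta (lam s).1)
        ('D_zeta (hamiltonian G (lam t).1) (lam t).2)) /\
    (forall v : ccpt R n,
      is_derive t (1 : R) (fun s => pairing (lam s).2 v)
        (- 'D_v (fun q => hamiltonian G q (lam t).2) (lam t).1)).

(* The fibre over p of the exponential map pi o e^{vec H} based at p_0. *)
Definition geodesics_to (R : realType) (n : nat) (G : contact_carnot R n)
    (p : ccpt R n) : set (ccpt R n) :=
  [set eta | exists2 lam, hamiltonian_curve G lam &
    lam 0 = (0, eta) /\ (lam 1).1 = p].

Definition betahat (R : realType) (n : nat) (G : contact_carnot R n)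
    (p : ccpt R n) : \bar R :=
  total_betti R (geodesics_to G p : topologicalType).

(** * Singular values and the constant *)

Definition singular_value (R : realType) (m : nat) (A : 'M[R]_m) (a : R) :=
  (0 <= a) && eigenvalue (A^T *m A) (a ^+ 2).

Definition distinct_singular_values (R : realType) (m : nat) (A : 'M[R]_m)
    (al : seq R) : Prop :=
  sorted <%R al /\ forall a, (a \in al) = singular_value A a.

(* Orthogonal projection onto the invariant subspace of the singular value a. *)
Definition sv_proj (R : realType) (m : nat) (A : 'M[R]_m) (a : R)
    (x : 'rV[R]_m) : 'rV[R]_m :=
  let E := eigenspace (A^T *m A) (a ^+ 2) in x *m proj_mx E (kermx E^T).

(* Indices of singular values start at 0 here. *)
Definition I0 (R : realType) (m : nat) (A : 'M[R]_m) (al : seq R)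
    (x : 'rV[R]_m) : pred nat :=
  fun j => sv_proj A al`_j x == 0.

Definition delta' (R : realType) (al : seq R) (I : pred nat) : R :=
  (\sum_(0 <= j < size al | ~~ I j)
     al`_0 / al`_j * (Num.floor (al`_j / al`_0))%:~R)^-1.

Definition C1' (R : realType) (al : seq R) (I : pred nat) : R :=
  8 / pi * (al`_0 / al`_(size al).-1 ^+ 2) * sin (delta' al I * pi / 2) ^+ 2.

Definition admissible (R : realType) (al : seq R) : Prop :=
  [/\ al != [::], sorted <%R al & forall a, a \in al -> 0 < a].

Definition homogeneous (R : realType) (d : int) (F : seq R -> R) : Prop :=
  forall (al : seq R) (l : R), admissible al -> 0 < l ->
    F [seq l * a | a <- al] = l ^ d * F al.

(* The norm of the scalar product of g_1 in the coordinates of the orthonormal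
   frame; `|x| would be the sup norm. *)
Definition enorm (R : realType) (m : nat) (x : 'rV[R]_m) : R :=
  Num.sqrt (\sum_i x ord0 i ^+ 2).

Definition lower_bound (R : realType) (n : nat) (C R1 : R) (p : ccpt R n) :
    \bar R :=
  if p.1 == 0 then +oo%E else (C * (`|p.2| / enorm p.1 ^+ 2) + R1)%:E.

(** * Consistency of the coordinate description *)

Lemma cc_br_suml (R : realType) (n : nat) (G : contact_carnot R n) (I : finType)
    (a : I -> R) (u : I -> cc_lie G) (w : cc_lie G) :
  cc_br (\sum_i a i *: u i) w = \sum_i a i *: cc_br (u i) w.
Proof.
have br0 : cc_br 0 w = 0.
  by have := cc_br_linl (-1) 0 0 w; rewrite scaler0 add0r scaleN1r addNr.
apply: (big_ind2 (fun x y => cc_br x w = y)) => //.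
- move=> x1 x2 y1 y2 <- <-.
  by rewrite -[x1 in LHS]scale1r cc_br_linl scale1r.
- by move=> i _; rewrite -[a i *: u i]addr0 cc_br_linl br0 addr0.
Qed.

Lemma cc_br_sumr (R : realType) (n : nat) (G : contact_carnot R n) (I : finType)
    (a : I -> R) (u : I -> cc_lie G) (w : cc_lie G) :
  cc_br w (\sum_i a i *: u i) = \sum_i a i *: cc_br w (u i).
Proof.
have br0 : cc_br w 0 = 0.
  by have := cc_br_linr (-1) w 0 0; rewrite scaler0 add0r scaleN1r addNr.
apply: (big_ind2 (fun x y => cc_br w x = y)) => //.
- move=> x1 x2 y1 y2 <- <-.
  by rewrite -[x1 in LHS]scale1r cc_br_linr scale1r.
- by move=> i _; rewrite -[a i *: u i]addr0 cc_br_linr br0 addr0.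
Qed.

Lemma cc_br_log (R : realType) (n : nat) (G : contact_carnot R n)
    (p q : ccpt R n) :
  cc_br (cc_log G p) (cc_log G q) =
  (p.1 *m cc_A G *m q.1^T) ord0 ord0 *: cc_f0 G.
Proof.
have f0g2 : cc_f0 G \in cc_g2 G by rewrite -cc_f0_gen memv_line.
have zf0 z : z *: cc_f0 G \in cc_g2 G by rewrite memvZ.
have fg1 i : cc_f G i \in cc_g1 G.
  have /basis_mem -> // := cc_f_basis G.
  by rewrite map_f // mem_enum.
have g1S (x : 'rV_(n.*2)) : \sum_i x ord0 i *: cc_f G i \in cc_g1 G.
  by apply: memv_suml => i _; rewrite memvZ.
have brD u v w : cc_br (u + v) w = cc_br u w + cc_br v w :> cc_lie G.
  by rewrite -[u in LHS]scale1r cc_br_linl scale1r.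
have brDr u v w : cc_br w (u + v) = cc_br w u + cc_br w v :> cc_lie G.
  by rewrite -[u in LHS]scale1r cc_br_linr scale1r.
have br21 u v : u \in cc_g2 G -> v \in cc_g1 G -> cc_br u v = 0.
  move=> u2 v1; have := cc_br_alt (u + v).
  rewrite brD !brDr !cc_br_alt (cc_br12 v1 u2) !addr0 add0r => h.
  exact: h.
rewrite /cc_log brD !brDr (cc_br12 (g1S _) (zf0 _)) (br21 _ _ (zf0 _) (g1S _)).
rewrite (cc_br22 (zf0 _) (zf0 _)) !addr0 cc_br_suml.
rewrite mxE scaler_suml.
under eq_bigr => i _ do rewrite cc_br_sumr scaler_sumr.
rewrite exchange_big /=; apply: eq_bigr => j _.
rewrite !mxE mulr_suml scaler_suml; apply: eq_bigr => i _.
by rewrite cc_AE !scalerA; congr (_ *: _); rewrite mulrAC.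
Qed.

Lemma cc_mul_BCH (R : realType) (n : nat) (G : contact_carnot R n)
    (p q : ccpt R n) :
  cc_log G (cc_mul G p q) =
  cc_log G p + cc_log G q + 2^-1 *: cc_br (cc_log G p) (cc_log G q).
Proof.
rewrite cc_br_log /cc_log /= !scalerDl scalerA.
under eq_bigr => i _ do rewrite mxE scalerDl.
rewrite big_split /= -!addrA; congr (_ + _); rewrite !addrA; congr (_ + _).
by congr (_ + _); rewrite addrC.
Qed.

Lemma linv_fieldE (R : realType) (n : nat) (G : contact_carnot R n)
    (v p : ccpt R n) :
  linv_field G v p =
  (v.1, v.2 + 2^-1 * (p.1 *m cc_A G *m v.1^T) ord0 ord0).
Proof.
rewrite /linv_field; set w := (X in _ = X).
have -> : (fun s : R => cc_mul G p (s *: v)) = (fun s : R => p + s *: w).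
  apply/funext => s; rewrite /cc_mul /w /=; congr pair.
  rewrite linearZ /= -scalemxAr mxE /=.
  by rewrite [s *: _ in RHS]/GRing.scale /= mulrDr mulrCA addrA.
have dw : is_derive (0 : R) (1 : R) (fun s : R => s *: w) w.
  have dw := @is_diff_scalel R _ (0 : R) w.
  by apply: DeriveDef; [exact: diff_derivable | rewrite deriveE // diff_val scale1r].
rewrite derive1E (_ : (fun _ => _) = cst p \+ (fun s : R => s *: w)) //.
by rewrite deriveD // derive_cst add0r derive_val.
Qed.

Lemma cc_dot_enorm (R : realType) (n : nat) (G : contact_carnot R n)
    (x : 'rV[R]_(n.*2)) :
  cc_dot (cc_log G (x, 0)) (cc_log G (x, 0)) = enorm x ^+ 2.
Proof.
have fg1 i : cc_f G i \in cc_g1 G.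
  have /basis_mem -> // := cc_f_basis G.
  by rewrite map_f // mem_enum.
have dot0 w : w \in cc_g1 G -> cc_dot 0 w = 0.
  move=> w1; have := cc_dot_lin (mem0v _) (mem0v _) w1 (-1).
  by rewrite scaler0 add0r mulN1r addNr.
have dotS w : w \in cc_g1 G ->
    cc_dot (\sum_i x ord0 i *: cc_f G i) w = \sum_i x ord0 i * cc_dot (cc_f G i) w.
  move=> w1.
  have [] : \sum_i x ord0 i *: cc_f G i \in cc_g1 G /\
    cc_dot (\sum_i x ord0 i *: cc_f G i) w =
    \sum_i x ord0 i * cc_dot (cc_f G i) w; last by [].
  apply: (big_ind2 (fun u s => u \in cc_g1 G /\ cc_dot u w = s)).
  - by rewrite mem0v dot0.
  - move=> u1 s1 u2 s2 [u1g <-] [u2g <-]; split; first exact: memvD.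
    by rewrite -[u1 in LHS]scale1r cc_dot_lin // mul1r.
  - move=> i _; split; first by rewrite memvZ.
    by rewrite -[x ord0 i *: _]addr0 cc_dot_lin ?mem0v // dot0 // addr0.
have xg1 : \sum_i x ord0 i *: cc_f G i \in cc_g1 G.
  by apply: memv_suml => i _; rewrite memvZ.
rewrite /cc_log /= scale0r addr0 dotS // sqr_sqrtr; last first.
  by apply: sumr_ge0 => i _; exact: sqr_ge0.
apply: eq_bigr => i _; rewrite cc_dot_sym // dotS // (bigD1 i) //= cc_f_orth eqxx.
rewrite mulr1 big1 ?addr0 ?expr2 // => j ji.
by rewrite cc_f_orth (negbTE ji) mulr0.
Qed.

(* Main.v *)
Require Import Defs.
From HB Require Import structures.
From mathcomp Require Import complex.
From mathcomp Require Import all_boot all_order all_algebra.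
From mathcomp Require Import all_classical all_reals all_analysis.
From mathcomp Require Import ring lra.

(** In the frame of left-invariant momenta the geodesic equations become
    [h' = zeta h A], so a covector [(eta, zeta)] with [zeta <> 0] reaches [(x, z)] iff
    [h(1) = eta + zeta x A] and [2 zeta z = |eta|^2 - <eta, x>].  Splitting along the
    planes of the singular values, for [zeta] off the resonances this is the single
    equation [F(zeta) = z] with
    [F(zeta) = sum_j |x_j|^2 alpha_j/8 (t_j - sin t_j) / sin^2 (t_j/2)], [t_j = zeta alpha_j],
    and at a pole of [F] there is no geodesic.  Hence every gap between consecutive
    poles that contains a point [v] with [F(v) < |z|] yields two geodesics; they lie in
    different path components of the fibre, since [zeta] is continuous and omits a value
    between them.  Over the center ([x = 0]) infinitely many resonances occur.

    To count the gaps, [F] is estimated at their midpoints by the length of the gap.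
    A linear minorant of [sin^2] bounds the sum of these estimates over one long block,
    because the gap lengths add up to the length of the block and the number of gaps is
    known.  A single period need not contain a good gap, so the block is moved along
    almost periods of all the frequencies, which occur with bounded spacing. *)

Set Implicit Arguments.
Unset Strict Implicit.
Unset Printing Implicit Defensive.

Import Order.TTheory GRing.Theory Num.Theory numFieldNormedType.Exports.

Local Open Scope classical_set_scope.
Local Open Scope ring_scope.

(** * Trigonometric inequalities *)

(** At the midpoint [v] of a gap of length [l], every [b v] is at distance at least [b l / 2] from
    the integers. Concavity of the sine then gives [sin^2 (pi b v) >= (b / beta)^2 sin^2 (beta l pi
    / 2)], with [beta] the largest frequency, and [b^2] cancels against the numerator of the term of
    [b], of size [2 pi v b^2]. So the condition on [v] does not see how [|x|^2] is shared among the
    planes. With [T = 8 |z| / (beta |x|)^2], the copies of the gap are good up to a height of about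
    [T sin^2 (beta l pi / 2) / (2 pi)]; two geodesics per copy give the factor [8 / pi].

    What remains is a density inequality: per unit length, the sum of [sin^2 (beta l pi / 2)] over
    the gaps must exceed [alpha_1 sin^2 (delta' pi / 2)]. If [A s - B <= sin^2 (s pi / 2)] on
    [[0, 1]], that density is at least [A beta - B S], with [S] the sum of the frequencies. A
    tangent to [s^2] suffices for [delta' <= 1/2]; otherwise there are at most three frequencies and
    one explicit line does. The slack pays for the ends of the block and the error of the almost
    periods; a single frequency may leave no slack and is counted directly. *)

Section Trigonometry.
Context {R : realType}.
Implicit Types t a l m x : R.

Lemma is_derive_sin_scale a x : is_derive x 1 (fun s : R => sin (a * s)) (a * cos (a * x)).
Proof.
have d : is_derive x 1 (fun s : R => a *: s) (a *: 1) by exact: is_deriveZ.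
have h := @is_derive1_comp R sin _ x _ _ (is_derive_sin _) d.
apply: is_derive_eq h _.
by rewrite /GRing.scale /= mulr1 mulrC.
Qed.

Lemma is_derive_cos_scale a x :
  is_derive x 1 (fun s : R => cos (a * s)) (- (a * sin (a * x))).
Proof.
have d : is_derive x 1 (fun s : R => a *: s) (a *: 1) by exact: is_deriveZ.
have h := @is_derive1_comp R cos _ x _ _ (is_derive_cos _) d.
apply: is_derive_eq h _.
by rewrite /GRing.scale /= mulr1 mulrC mulrN.
Qed.

(** Concavity of the sine on [[0, pi]]: the derivative [t (cos (t x) - cos x)] of the difference is
    nonnegative because the cosine decreases there. *)
Lemma sin_scale_ge t a : 0 <= t <= 1 -> 0 <= a <= pi -> t * sin a <= sin (t * a).
Proof.
move=> /andP[t0 t1] /andP[a0 api].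
pose g x := sin (t * x) - t * sin x.
have dg (x : R) : is_derive x 1 g (t * cos (t * x) - t * cos x).
  by apply: is_deriveB; apply: is_derive_sin_scale.
have cg : {within `[0, a], continuous g}.
  apply: derivable_within_continuous => x _.
  exact: (@ex_derive _ _ _ _ _ _ _ (dg x)).
have [c + gE] := MVT_segment a0 (fun x _ => dg x) cg.
rewrite in_itv /= => /andP[c0 ca].
rewrite -subr_ge0 -/(g a).
have -> : g a = g a - g 0 by rewrite /g mulr0 sin0 mulr0 !subr0.
rewrite gE subr0 mulr_ge0 // -mulrBr mulr_ge0 // subr_ge0 leNgt.
have tcc : t * c <= c by rewrite ler_piMl.
have cpi : c <= pi := le_trans ca api.
have tc0 : 0 <= t * c by rewrite mulr_ge0.
by rewrite ltr_cos ?in_itv /= ?c0 ?cpi ?tc0 ?(le_trans tcc) // -leNgt.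
Qed.

Lemma sin_le_pihalf x y : 0 <= x -> x <= y -> y <= pi / 2 -> sin x <= sin y.
Proof.
move=> x0 xy yp; rewrite leNgt; have p0 := @pi_gt0 R.
by rewrite ltr_sin ?in_itv /= -?leNgt //; lra.
Qed.

(** Transfers an estimate at the largest frequency to a smaller one, [t] being the ratio of the
    two. *)
Lemma sinsq_scale t l : 0 <= t <= 1 -> 0 <= l <= 1 ->
  t ^+ 2 * sin (l * pi / 2) ^+ 2 <= sin (t * l * pi / 2) ^+ 2.
Proof.
move=> t01 /andP[l0 l1]; have p0 := @pi_gt0 R; have /andP[t0 t1] := t01.
have lp : 0 <= l * pi / 2 <= pi by nra.
have h := sin_scale_ge t01 lp.
have s0 : 0 <= sin (l * pi / 2) by apply: sin_ge0_pi.
rewrite -exprMn (_ : t * l * pi / 2 = t * (l * pi / 2)); last by ring.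
by rewrite lerXn2r // nnegrE ?(le_trans _ h) // mulr_ge0.
Qed.

Lemma sinsq_ge_sqr l : 0 <= l <= 1 -> l ^+ 2 <= sin (l * pi / 2) ^+ 2.
Proof.
move=> l01; have := sinsq_scale (l := 1) l01.
rewrite !mulr1 mul1r sin_pihalf expr1n mulr1; apply.
by rewrite lexx ler01.
Qed.

Lemma sinsq_sym l : sin ((1 - l) * pi / 2) ^+ 2 = 1 - sin (l * pi / 2) ^+ 2.
Proof.
have -> : (1 - l) * pi / 2 = - (l * pi / 2 - pi / 2) by ring.
by rewrite sinN sinBpihalf opprK cos2sin2.
Qed.

Lemma sinsq_mono l m : 0 <= l -> l <= m -> m <= 1 ->
  sin (l * pi / 2) ^+ 2 <= sin (m * pi / 2) ^+ 2.
Proof.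
move=> l0 lm m1; have p0 := @pi_gt0 R.
have h : sin (l * pi / 2) <= sin (m * pi / 2) by apply: sin_le_pihalf; nra.
have s0 : 0 <= sin (l * pi / 2) by apply: sin_ge0_pi; nra.
by rewrite lerXn2r // nnegrE ?(le_trans _ h).
Qed.

Lemma sinsq_ge_2sqr l : 0 <= l <= 2^-1 -> 2 * l ^+ 2 <= sin (l * pi / 2) ^+ 2.
Proof.
move=> /andP[l0 l1]; have h2 : sin (2^-1 * pi / 2) ^+ 2 = 2^-1 :> R.
  have := sinsq_sym 2^-1; rewrite (_ : 1 - 2^-1 = 2^-1); last by lra.
  by lra.
have := @sinsq_scale (2 * l) 2^-1.
rewrite h2 (_ : 2 * l * 2^-1 = l); last by field.
move=> h; apply: le_trans (h _ _); first by rewrite exprMn; lra.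
  by lra.
by lra.
Qed.

(** Equivalent to [cos (l pi) >= 1 - 2 l]: the cosine lies above its chord on [[0, pi / 2]]. *)
Lemma sinsq_le_id l : 0 <= l <= 2^-1 -> sin (l * pi / 2) ^+ 2 <= l.
Proof.
move=> /andP[l0 l1]; have p0 := @pi_gt0 R.
have h : (1 - 2 * l) <= sin ((1 - 2 * l) * (pi / 2)).
  have := @sin_scale_ge (1 - 2 * l) (pi / 2).
  by rewrite sin_pihalf mulr1; apply; lra.
have e : sin ((1 - 2 * l) * (pi / 2)) = 1 - 2 * sin (l * pi / 2) ^+ 2.
  have -> : (1 - 2 * l) * (pi / 2) = - ((l * pi / 2) *+ 2 - pi / 2).
    by rewrite mulr2n; field.
  by rewrite sinN sinBpihalf opprK cos_mulr2n cos2sin2 mulr2n; ring.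
by rewrite e in h; lra.
Qed.

(** A line through [(1, 1)]. Its slope is a rational number just above [4 - 2 sqrt 2], the least
    slope for which such a line stays below [2 l^2]; beyond [1/2] the squared sine is at least [l]
    by symmetry. *)
Lemma sinsq_ge_line l : 0 <= l <= 1 -> 6 / 5 * l - 5^-1 <= sin (l * pi / 2) ^+ 2.
Proof.
move=> /andP[l0 l1]; have [lh|lh] := leP l 2^-1.
  apply: le_trans (sinsq_ge_2sqr _); last by rewrite l0.
  by have := sqr_ge0 (l - 3 / 10); nra.
have := sinsq_sym l; have : sin ((1 - l) * pi / 2) ^+ 2 <= 1 - l.
  by apply: sinsq_le_id; lra.
by lra.
Qed.

Lemma sinsq_le_two_thirds l : 0 <= l -> l <= 2 / 3 -> sin (l * pi / 2) ^+ 2 <= 7 / 9.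
Proof.
move=> l0 l23; have l1 : 2 / 3 <= 1 :> R by lra.
apply: le_trans (sinsq_mono l0 l23 l1) _.
have -> : 2 / 3 = 1 - 3^-1 :> R by field.
rewrite sinsq_sym; have := @sinsq_ge_2sqr 3^-1.
have -> : 2 * 3^-1 ^+ 2 = 2 / 9 :> R by field.
have h3 : 0 <= (3^-1 : R) <= 2^-1 by lra.
by move=> /(_ h3); lra.
Qed.

Lemma sinsq_le1 x : sin x ^+ 2 <= 1.
Proof. by rewrite sin2cos2 gerBl sqr_ge0. Qed.

End Trigonometry.

(** * Counting the gaps between poles *)

Section Recurrence.
Context {R : realType}.

(** Pigeonhole on the torus: the fractional parts of the [b a] fall into finitely many cells, and
    every occupied cell keeps one representative. Subtracting from [a + l] the representative of its
    cell gives an almost period. All representatives are bounded by one [l], so every window of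
    length [l + l] contains such a period. *)
Lemma almost_period (bs : seq R) (e : R) : 0 < e ->
  exists2 l : R, 0 <= l & forall a : R, exists2 t : R, a <= t <= a + l &
    forall b, b \in bs -> exists m : int, `|b * t - m%:~R| <= e.
Proof.
move=> e0; pose M := Num.truncn e^-1.
have eM : M.+1%:R^-1 <= e.
  by rewrite -[e]invrK lef_pV2 ?posrE ?invr_gt0 // ltW // truncnS_gt.
pose frac (x : R) := x - (Num.floor x)%:~R.
have frac0 x : 0 <= frac x by rewrite subr_ge0 floor_le.
have frac1 x : frac x < 1 by rewrite ltrBlDl -[1]/(1%:~R) -intrD floorD1_gt.
pose c x : 'I_M.+1 := inord (Num.truncn (M.+1%:R * frac x)).
have cE x : c x = Num.truncn (M.+1%:R * frac x) :> nat.
  rewrite inordK // truncn_lt_nat // ?mulr_ge0 //.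
  by rewrite gtr_pMr ?ltr0n.
have cP x y : c x = c y -> `|frac x - frac y| <= e.
  move=> /(congr1 (@nat_of_ord _)); rewrite !cE => cxy.
  have hx : (Num.truncn (M.+1%:R * frac x))%:R <= M.+1%:R * frac x.
    by rewrite truncn_le mulr_ge0.
  have hy : (Num.truncn (M.+1%:R * frac y))%:R <= M.+1%:R * frac y.
    by rewrite truncn_le mulr_ge0.
  have hx' := truncnS_gt (M.+1%:R * frac x).
  have hy' := truncnS_gt (M.+1%:R * frac y).
  rewrite cxy in hx hx'; apply: le_trans eM.
  rewrite -(ler_pM2l (ltr0Sn R M)) mulfV ?pnatr_eq0 //.
  rewrite -[X in X * _ <= _]ger0_norm // -normrM ler_norml mulrBr.
  by rewrite -(natr1 (Num.truncn _)) in hx' hy'; lra.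
pose cell a : {ffun 'I_(size bs) -> 'I_M.+1} := [ffun j => c (bs`_(val j) * a)].
pose r z := xget 0 [set a | cell a = z].
pose l := \sum_z `|r z|.
have l0 : 0 <= l by apply: sumr_ge0.
exists (l + l); first by rewrite addr_ge0.
move=> a; have rP : cell (r (cell (a + l))) = cell (a + l).
  by apply: (@xgetPex _ 0 [set a' | cell a' = cell (a + l)]); exists (a + l).
set s := r _ in rP; have sl : `|s| <= l.
  by rewrite /l (bigD1 (cell (a + l))) //= lerDl sumr_ge0.
exists (a + l - s) => [|b bbs]; first by move: sl; rewrite ler_norml; lra.
have lt_b : (index b bs < size bs)%N by rewrite index_mem.
exists (Num.floor (b * (a + l)) - Num.floor (b * s)).
have /cP : c (b * (a + l)) = c (b * s).
  move/ffunP/(_ (Ordinal lt_b)): rP; rewrite !ffunE /=.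
  by rewrite nth_index // => ->.
by rewrite /frac intrB mulrBr; congr (`|_| <= _); ring.
Qed.

(* Resonances, in the variable [u = zeta / (2 pi)]. *)
Definition pole (bs : seq R) (p : R) : Prop :=
  exists2 b, b \in bs & exists m : int, p * b = m%:~R.

Lemma pole_after (bs : seq R) b (x : R) : b \in bs -> 0 < b ->
  exists2 p, pole bs p & x < p <= x + b^-1.
Proof.
move=> bbs b0; exists ((Num.floor (x * b) + 1)%:~R / b).
  by exists b => //; exists (Num.floor (x * b) + 1); rewrite divfK // gt_eqF.
rewrite ltr_pdivlMr // floorD1_gt ler_pdivrMr // mulrDl mulVf ?gt_eqF //.
by rewrite intrD lerD2r floor_le.
Qed.

Lemma sin_int_shift (x : R) (m : int) : sin (x + m%:~R * pi) ^+ 2 = sin x ^+ 2.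
Proof.
have h (n : nat) (y : R) : sin (y + n%:R * pi) ^+ 2 = sin y ^+ 2.
  elim: n => [|n IH] in y *; first by rewrite mul0r addr0.
  by rewrite -natr1 mulrDl mul1r addrA sinDpi sqrrN.
case: m => n; first exact: h.
by rewrite NegzE intrN mulNr -(h n.+1 (x - _)) subrK.
Qed.

(** [sin^2 (pi y)] is periodic and even, hence an increasing function of the distance from [y] to
    the integers. *)
Lemma sinsq_dist_int (y d : R) : 0 <= d -> (forall m : int, d <= `|y - m%:~R|) ->
  sin (d * pi) ^+ 2 <= sin (y * pi) ^+ 2.
Proof.
move=> d0 dy; set r := y - (Num.floor y)%:~R.
have p0 := @pi_gt0 R.
have r0 : 0 <= r by rewrite subr_ge0 floor_le.
have r1 : r < 1 by rewrite ltrBlDl -[1]/(1%:~R) -intrD floorD1_gt.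
have dr : d <= r by have := dy (Num.floor y); rewrite -/r ger0_norm.
have dr1 : d <= 1 - r.
  have := dy (Num.floor y + 1); rewrite intrD opprD addrA -/r.
  by rewrite ltr0_norm ?subr_lt0 // opprB.
have -> : sin (y * pi) ^+ 2 = sin (r * pi) ^+ 2.
  by rewrite -(sin_int_shift (r * pi) (Num.floor y)) -mulrDl subrK.
have h x : 0 <= x -> x <= 2^-1 -> d <= x -> sin (d * pi) ^+ 2 <= sin (x * pi) ^+ 2.
  move=> x0 x2 dx; have -> : d * pi = (2 * d) * pi / 2 by field.
  have -> : x * pi = (2 * x) * pi / 2 by field.
  by apply: sinsq_mono; lra.
have [rh|rh] := leP r 2^-1; first exact: h.
have -> : sin (r * pi) ^+ 2 = sin ((1 - r) * pi) ^+ 2.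
  by rewrite -(sin_int_shift _ (-1)) -[LHS]sqrrN -sinN; congr (sin _ ^+ 2); ring.
by apply: h => //; lra.
Qed.

End Recurrence.

(** * Good gaps in blocks moved by almost periods *)

Section Counting.
Context {R : realType}.
Implicit Types (bs : seq R) (b T : R).

(** The multiples [m / b] in [[0, L]] are sorted with repetitions, so a pole shared by several
    frequencies produces gaps of length 0. Repetitions make the number of gaps easy to bound, and
    the empty gaps are later discarded as too short. *)
Lemma pole_gaps bs (beta L : R) : 0 <= L -> beta \in bs ->
  (forall b, b \in bs -> 0 < b) ->
  exists n (p : nat -> R),
  [/\ n%:R <= (\sum_(b <- bs) b) * L + (size bs)%:R,
      forall i, (i <= n)%N -> 0 <= p i <= L /\ pole bs (p i),
      L - beta^-1 <= p n - p 0%N,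
      forall i j, (i <= j <= n)%N -> p i <= p j &
      forall i q, (i < n)%N -> pole bs q -> q <= p i \/ p i.+1 <= q].
Proof.
move=> L0 betabs bs0; have beta0 := bs0 _ betabs.
pose blk b := [seq m%:R / b | m <- iota 0 (Num.truncn (b * L)).+1].
pose ps := sort <=%R (flatten [seq blk b | b <- bs]).
have psP q : reflect (exists2 b, b \in bs & exists2 m : nat,
    m%:R <= b * L & q = m%:R / b) (q \in ps).
  rewrite mem_sort; apply: (iffP flatten_mapP) => -[b bbs].
    case/mapP => m; rewrite mem_iota add0n /= => mL ->; exists b => //; exists m => //.
    by move: mL; rewrite ltnS truncn_ge_nat // mulr_ge0 // ltW // bs0.
  case=> m mL ->; exists b => //; apply/mapP; exists m => //.
  by rewrite mem_iota add0n /= ltnS truncn_ge_nat // mulr_ge0 // ltW // bs0.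
have ps_sorted : sorted <=%R ps by apply: sort_sorted; exact: le_total.
have mono i j : (i <= j)%N -> (j < size ps)%N -> ps`_i <= ps`_j.
  move=> ij js; apply: (sorted_leq_nth le_trans le_refl) => //.
  by rewrite inE (leq_ltn_trans ij).
have in_ps q : pole bs q -> 0 <= q <= L -> q \in ps.
  case=> b bbs [m qb] /andP[q0 qL]; have b0 := bs0 _ bbs.
  have m0 : (0 : R) <= m%:~R by rewrite -qb mulr_ge0 // ltW.
  case: m qb m0 => m qb m0; last by move: m0; rewrite ler0z.
  apply/psP; exists b => //; exists m.
    by rewrite -[m%:R]/(m%:~R) -qb mulrC ler_pM2l.
  by rewrite -[m%:R]/(m%:~R) -qb mulfK // gt_eqF.
have ps_in q : q \in ps -> 0 <= q <= L /\ pole bs q.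
  case/psP => b bbs [m mL ->]; have b0 := bs0 _ bbs; split.
    by rewrite divr_ge0 ?ler0n ?(ltW b0) //= ler_pdivrMr // mulrC.
  by exists b => //; exists m; rewrite divfK // gt_eqF.
have ps0 : 0 \in ps.
  by apply/psP; exists beta => //; exists 0%N; rewrite ?mul0r // mulr_ge0 // ltW.
have sz0 : (0 < size ps)%N by case: (ps) ps0.
have le_n i : (i <= (size ps).-1)%N -> (i < size ps)%N.
  by move=> h; rewrite -(prednK sz0).
exists (size ps).-1, (fun i => ps`_i); split.
- have -> : (size ps = \sum_(b <- bs) (Num.truncn (b * L)).+1)%N.
    rewrite size_sort size_flatten /shape sumnE !big_map.
    by apply: eq_bigr => b _; rewrite size_map size_iota.
  apply: (@le_trans _ _ ((\sum_(b <- bs) (Num.truncn (b * L)).+1)%N%:R)).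
    by rewrite ler_nat leq_pred.
  rewrite natr_sum mulr_suml -sum1_size natr_sum -big_split /=.
  rewrite big_seq [leRHS]big_seq; apply: ler_sum => b bbs; rewrite -natr1 lerD2r truncn_le mulr_ge0 // ltW //.
  exact: bs0.
- by move=> i /le_n/(mem_nth 0)/ps_in.
- have : ps`_0 <= 0.
    by rewrite -[leRHS](nth_index 0 ps0); apply: mono; rewrite ?index_mem.
  set m := Num.truncn (beta * L).
  have bL0 : 0 <= beta * L by rewrite mulr_ge0 // ltW.
  have mP : m%:R / beta \in ps.
    by apply/psP; exists beta => //; exists m; rewrite // truncn_le.
  have : m%:R / beta <= ps`_(size ps).-1.
    rewrite -{1}(nth_index 0 mP); apply: mono; last by rewrite prednK.
    by rewrite -ltnS prednK // index_mem.
  have : L - beta^-1 <= m%:R / beta.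
    rewrite ler_pdivlMr // mulrBl mulVf ?gt_eqF // lerBlDr natr1 mulrC.
    by rewrite ltW // truncnS_gt.
  by lra.
- by move=> i j /andP[ij /le_n]; apply: mono.
- move=> i q ltin pq; have lti1 : (i.+1 < size ps)%N by rewrite -ltn_predRL.
  have /ps_in[/andP[i0 iL] _] := mem_nth 0 (ltnW lti1).
  have /ps_in[/andP[i10 i1L] _] := mem_nth 0 lti1.
  have [q0|q0] := ltP q 0; first by left; rewrite ltW // (lt_le_trans q0).
  have [qL|qL] := leP q L; last by right; rewrite (le_trans i1L) // ltW.
  have qps : q \in ps by apply: in_ps; rewrite ?q0.
  rewrite -(nth_index 0 qps); have [ji|ij] := leqP (index q ps) i.
    by left; apply: mono => //; apply: ltnW.
  by right; apply: mono => //; rewrite index_mem.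
Qed.

(* [T] stands for [8 |z| / (beta |x|)^2]: the third clause gives [F (2 pi (v i)) < |z|]. *)
Definition good_points_bound (K : R) bs (beta Q : R) : Prop :=
  forall T, 0 <= T ->
  exists (I : finType) (v : I -> R),
  [/\ Q * T / (2 * pi) - K <= #|I|%:R,
      forall i, exists2 p, pole bs p & 0 < p < v i,
      forall i b, b \in bs ->
        b * (2 * pi * v i * b + 1) < beta ^+ 2 * T * sin (b * v i * pi) ^+ 2 &
      forall i j, i != j -> exists2 p, pole bs p & v i < p < v j \/ v j < p < v i].

Definition has_good_points bs (beta Q : R) : Prop :=
  exists K, good_points_bound K bs beta Q.

(* Recurrence: a shift [t] that is almost a common period of all the pole
   lattices carries the long gaps of a fixed block into gaps everywhere else. *)
Lemma good_points bs (beta A B Q : R) : beta \in bs ->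
  (forall b, b \in bs -> 0 < b <= beta) -> 0 <= A <= 2 -> 0 <= B ->
  (forall l : R, 0 <= l <= 1 -> A * l - B <= sin (l * pi / 2) ^+ 2) ->
  0 <= Q < A * beta - B * \sum_(b <- bs) b ->
  has_good_points bs beta Q.
Proof.
move=> betabs bsP /andP[A0 A2] B0 minor /andP[Q0 QP].
have bs0 b : b \in bs -> 0 < b by case/bsP/andP.
have beta0 := bs0 _ betabs; have p0 := @pi_gt0 R.
set S := \sum_(b <- bs) b in QP *; set k : R := (size bs)%:R.
have S0 : 0 < S.
  rewrite /S (big_rem beta) //= ltr_wpDr // big_seq sumr_ge0 // => b.
  by move=> /mem_rem/bs0/ltW.
have k0 : 0 <= k by rewrite /k ler0n.
pose c1 := \sum_(b <- bs) b^-1.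
have c1P b : b \in bs -> b^-1 <= c1.
  move=> bbs; rewrite /c1 (big_rem b) //= lerDl big_seq sumr_ge0 // => b'.
  by move=> /mem_rem/bs0/ltW; rewrite invr_ge0.
have c10 : 0 < c1 by apply: lt_le_trans (c1P _ betabs); rewrite invr_gt0.
(* How the slack [rho] is spent: [eps] is chosen with [4 * eps * S = rho / 2], and the other half,
   multiplied by [L], absorbs the boundary terms collected in [D]. The precision [e] satisfies
   [2 * e * beta <= b * eps] for every frequency, since [b^-1 <= c1]. *)
pose rho := A * beta - B * S - Q.
have rho0 : 0 < rho by rewrite /rho subr_gt0.
pose eps := rho / (8 * S).
have eps0 : 0 < eps by rewrite divr_gt0 // mulr_gt0.
pose e := eps / (2 * beta * c1).
have e0 : 0 < e by rewrite divr_gt0 // !mulr_gt0.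
have [l l0 perP] := almost_period bs e0.
pose D := A + B * k + 4 * eps * k + Q * (l + 2 / beta).
have D0 : 0 <= D.
  have lb0 : 0 <= l + 2 / beta by rewrite addr_ge0 // divr_ge0 // ltW.
  have := mulr_ge0 B0 k0; have := mulr_ge0 (ltW eps0) k0.
  by have := mulr_ge0 Q0 lb0; rewrite /D; lra.
pose L := 2 * D / rho + 1.
have L0 : 0 <= L by rewrite addr_ge0 // divr_ge0 ?mulr_ge0 // ltW.
have [n [p [nP pP pL pmono pgap]]] := pole_gaps L0 betabs bs0.
(* Block [i] lies in [[i L', i L' + l + L]], so consecutive blocks leave a free space of length at
   least [2 / beta], enough for a pole of [beta]. *)
pose L' := L + l + 2 / beta.
have ibeta0 : 0 < beta^-1 by rewrite invr_gt0.
have L'0 : 0 < L' by rewrite /L'; lra.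
have /choice[t tP] : forall i : nat, exists t,
    i%:R * L' <= t <= i%:R * L' + l /\
    forall b, b \in bs -> exists m : int, `|b * t - m%:~R| <= e.
  by move=> i; have [t h1 h2] := perP (i%:R * L'); exists t.
pose gap g := p g.+1 - p g.
pose h g := A * (beta * gap g - eps) - B.
have gap0 g : (g < n)%N -> 0 <= gap g by move=> gn; rewrite subr_ge0 pmono // leqnSn.
have gap1 g : (g < n)%N -> beta * gap g <= 1.
  move=> gn; have [q pq /andP[gq qg]] := pole_after (p g) betabs beta0.
  have [|h1] := pgap g q gn pq; first by rewrite leNgt gq.
  rewrite mulrC -ler_pdivlMr // mul1r /gap lerBlDl; exact: le_trans h1 qg.
pose w T g := (T * h g - c1) / (2 * pi * L').
(* Only gaps that the error of the almost periods cannot close are kept. The copy with index [j]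
   sits in block [j + 1], below [(j + 2) L'], and one more unit makes the inequality strict: hence
   [j + 3 <= w T g]. Block 0 is skipped so that a positive pole precedes every point. *)
pose cnt T g := if 2 * eps <= beta * gap g then (Num.truncn (w T g) - 2)%N else 0%N.
pose K := n%:R * (c1 / (2 * pi * L') + 3).
exists K => T T0; exists ({g : 'I_n & 'I_(cnt T g)} : finType).
pose u (g : 'I_n) := (p g + p g.+1) / 2.
have uP g : 0 <= u g /\ u g <= L.
  have [/andP[a1 a2] _] := pP g (ltnW (ltn_ord g)).
  have [/andP[b1 b2] _] := pP g.+1 (ltn_ord g).
  by rewrite /u; split; lra.
have jP (g : 'I_n) (j : 'I_(cnt T g)) : 2 * eps <= beta * gap g /\ j.+3%:R <= w T g.
  have := ltn_ord j; rewrite {2}/cnt; case: ifP => // rg.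
  by rewrite ltn_subRL add2n => jl; split => //; rewrite -truncn_gt_nat.
exists (fun x => u (tag x) + t (nat_of_ord (tagged x)).+1); split.
- have wP (g : 'I_n) : (T * (A * (beta * gap g) - B - 4 * eps) - c1) / (2 * pi * L') - 3
      <= (cnt T g)%:R.
    (* For a discarded gap the bound is not positive: as [A <= 2] and [beta * gap g < 2 * eps], the
       term [4 * eps] outweighs [A * (beta * gap g)]. *)
    rewrite /cnt; case: ifPn => [ret|]; last first.
      rewrite -ltNge => nret; apply: le_trans (lexx 0).
      rewrite subr_le0; apply: (@le_trans _ _ 0) => //.
      rewrite ler_pdivrMr ?mulr_gt0 // mul0r subr_le0; apply: le_trans (ltW c10).
      rewrite -oppr_ge0 -mulrN mulr_ge0 //.
      have := gap0 _ (ltn_ord g); have := ltW beta0 => b1 g1.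
      have := mulr_ge0 b1 g1; nra.
    have wle : (T * (A * (beta * gap g) - B - 4 * eps) - c1) / (2 * pi * L') <= w T g.
      rewrite ler_pM2r ?invr_gt0 ?mulr_gt0 // lerD2r ler_wpM2l // /h.
      by have := ltW eps0; nra.
    apply: (@le_trans _ _ (w T g - 3)); first by rewrite lerD2r.
    have [/truncn_itv /andP[_]|wneg] := leP 0 (w T g).
      rewrite -natr1; have [h2|h2] := leqP 2 (Num.truncn (w T g)).
        by rewrite natrB //; lra.
      have -> : (Num.truncn (w T g) - 2 = 0)%N by apply/eqP; rewrite subn_eq0 ltnW.
      have : (Num.truncn (w T g))%:R <= 1 :> R by rewrite -[1]/(1%:R) ler_nat -ltnS.
      by lra.
    by apply: (@le_trans _ _ 0); [lra | rewrite ler0n].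
  have -> : #|{: {g : 'I_n & 'I_(cnt T g)}}| = (\sum_(g < n) cnt T g)%N.
    rewrite card_tagged sumnE big_map big_enum /=.
    by apply: eq_bigr => g _; rewrite card_ord.
  rewrite natr_sum; apply: le_trans (ler_sum _ (fun g _ => wP g)).
  have sgap : \sum_(g < n) gap g = p n - p 0%N.
    by rewrite -(telescope_sumr p (leq0n n)) big_mkord.
  have -> : \sum_(g < n) ((T * (A * (beta * gap g) - B - 4 * eps) - c1) / (2 * pi * L') - 3)
     = T * (A * (beta * (p n - p 0%N)) - n%:R * (B + 4 * eps)) / (2 * pi * L') - K.
    rewrite (eq_bigr (fun g : 'I_n => T * A * beta / (2 * pi * L') * gap g
      - ((T * (B + 4 * eps) + c1) / (2 * pi * L') + 3))); last by move=> g _; ring.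
    by rewrite sumrB -mulr_sumr sgap sumr_const card_ord -[_ *+ n]mulr_natl /K; ring.
  rewrite lerD2r (_ : Q * T / (2 * pi) = T * (Q * L') / (2 * pi * L')); last first.
    by have := lt0r_neq0 p0; move: pi => c c0; field; rewrite c0 gt_eqF.
  rewrite ler_pM2r ?invr_gt0 ?mulr_gt0 // ler_wpM2l //.
  have epsE : 8 * eps * S = rho by rewrite /eps; field; rewrite gt_eqF.
  have LE : rho * (L - 1) = 2 * D by rewrite /L addrK; field; rewrite gt_eqF.
  have : beta * (L - beta^-1) <= beta * (p n - p 0%N) by rewrite ler_wpM2l // ltW.
  rewrite mulrBr mulfV ?gt_eqF // => /(ler_wpM2l A0) h1.
  have h2 := ler_wpM2r (addr_ge0 B0 (mulr_ge0 (ler0n R 4) (ltW eps0))) nP.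
  rewrite -/S -/k in h2.
  apply: le_trans (lerB h1 h2).
  have e1 : (S * L + k) * (B + 4 * eps) = B * S * L + rho / 2 * L + B * k + 4 * eps * k.
    by rewrite -epsE; field.
  rewrite e1 /L' /D in LE *; rewrite /rho in LE *; lra.
- move=> [g j]; exists beta^-1; first by exists beta => //; exists 1; rewrite mulVf ?gt_eqF.
  have [/andP[tj _] _] := tP j.+1; rewrite ibeta0 /=.
  have [u0 _] := uP g; have : 1 * L' <= j.+1%:R * L' by rewrite ler_pM2r // ler1n.
  by move: tj u0; rewrite /L' /=; lra.
- move=> [g j] b bbs /=; have [ret jw] := jP g j.
  have b0 := bs0 _ bbs; have /andP[_ bbeta] := bsP _ bbs.
  have [/andP[_ tj] /(_ _ bbs)[mt mtP]] := tP j.+1; have [u0 uL] := uP g.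
  set v := u g + t j.+1; pose lam := beta * gap g - eps.
  have lam01 : 0 <= lam <= 1.
    by have := gap1 _ (ltn_ord g); rewrite /lam; move: ret eps0; lra.
  have eb : 2 * e * beta <= b * eps.
    have -> : 2 * e * beta = eps / c1 by rewrite /e; field; rewrite !gt_eqF.
    by rewrite mulrC ler_pM2r // -[b]invrK lef_pV2 ?posrE ?invr_gt0 // c1P.
  have bb01 : 0 <= b / beta <= 1.
    by rewrite divr_ge0 ?(ltW b0) ?(ltW beta0) //= ler_pdivrMr // mul1r.
  (* The shift moves [b * u g] by at most [e] modulo the integers; the [eps] subtracted in [lam]
     pays for this. *)
  have dist (m : int) : b / beta * lam / 2 <= `|b * v - m%:~R|.
    have hb : b / beta * lam / 2 <= b * gap g / 2 - e.
      have -> : b / beta * lam / 2 = b * gap g / 2 - b * eps / beta / 2.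
        by rewrite /lam; field; rewrite gt_eqF.
      rewrite lerD2l lerN2 ler_pdivlMr // ler_pdivlMr //; lra.
    apply: le_trans hb _; have : b * gap g / 2 <= `|b * u g - (m - mt)%:~R|.
      have pq : pole bs ((m - mt)%:~R / b).
        by exists b => //; exists (m - mt); rewrite divfK ?gt_eqF.
      have -> : b * u g - (m - mt)%:~R = b * (u g - (m - mt)%:~R / b).
        by rewrite mulrBr [X in _ = _ - X]mulrC divfK ?gt_eqF.
      rewrite normrM (gtr0_norm b0) -mulrA ler_pM2l //.
      have := gap0 _ (ltn_ord g); rewrite /u /gap => g0.
      by case: (pgap g _ (ltn_ord g) pq) => hq; [rewrite ger0_norm | rewrite ler0_norm]; lra.
    have -> : b * v - m%:~R = (b * u g - (m - mt)%:~R) + (b * t j.+1 - mt%:~R).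
      by rewrite /v intrB; ring.
    move=> h1; have := ler_normB (b * u g - (m - mt)%:~R + (b * t j.+1 - mt%:~R)) (b * t j.+1 - mt%:~R).
    by rewrite addrK; move: h1 mtP; lra.
  have d0 : 0 <= b / beta * lam / 2.
    case/andP: bb01 => x0 _; case/andP: lam01 => y0 _.
    by apply: divr_ge0 => //; apply: mulr_ge0.
  have := sinsq_dist_int d0 dist.
  have -> : b / beta * lam / 2 * pi = b / beta * lam * pi / 2 by ring.
  have s1 := sinsq_scale bb01 lam01; have s2 := minor _ lam01 => s3.
  have hg : h g <= sin (lam * pi / 2) ^+ 2 by [].
  have s4 : b ^+ 2 * h g <= beta ^+ 2 * sin (b * v * pi) ^+ 2.
    have : b ^+ 2 * h g <= b ^+ 2 * sin (lam * pi / 2) ^+ 2 by rewrite ler_pM2l // exprn_gt0.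
    move=> /le_trans; apply; move: (le_trans s1 s3).
    rewrite -(ler_pM2l (exprn_gt0 2 beta0)) exprMn exprVn mulrA [_ ^+ 2 * (_ / _)]mulrC.
    by rewrite -[X in X * _ <= _]mulrA mulVf ?mulr1 // expf_neq0 // gt_eqF.
  rewrite [ltRHS]mulrAC; apply: lt_le_trans (ler_wpM2r T0 s4).
  have -> : b * (2 * pi * v * b + 1) = b ^+ 2 * (2 * pi * v + b^-1).
    by field; rewrite gt_eqF.
  rewrite -[ltRHS]mulrA ltr_pM2l ?exprn_gt0 // [h g * T]mulrC.
  apply: (@lt_le_trans _ _ (2 * pi * (j.+2%:R * L') + 2 * pi * L' + c1)); last first.
    move: jw; rewrite /w ler_pdivlMr ?mulr_gt0 // -(natr1 j.+2); lra.
  have vL : v <= j.+2%:R * L'.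
    rewrite -natr1 mulrDl mul1r /v; move: tj uL; rewrite /L'; lra.
  have := c1P _ bbs; have : 2 * pi * v <= 2 * pi * (j.+2%:R * L').
    by rewrite ler_pM2l // mulr_gt0.
  have : 0 < 2 * pi * L' by rewrite !mulr_gt0.
  by lra.
- have far g g' i i' : (i < i')%N ->
      exists2 q, pole bs q & u g + t i < q < u g' + t i'.
    move=> ii'; have [q pq qP] := pole_after (u g + t i) betabs beta0; exists q => //.
    have [/andP[_ ti] _] := tP i; have [/andP[ti' _] _] := tP i'.
    have [_ uL] := uP g; have [u0' _] := uP g'.
    have : i.+1%:R * L' <= i'%:R * L' by rewrite ler_pM2r // ler_nat.
    by rewrite -natr1 mulrDl mul1r; move: qP ti ti' uL u0' ibeta0; rewrite /L'; lra.
  (* Within one block the pole [p g.+1] need not be carried to a pole, but a pole lies within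
     [e / b] of its image. Kept gaps are at least [4 * e / b] long, so this pole still separates the
     midpoints. *)
  have near_ (g g' : 'I_n) (i : nat) : 2 * eps <= beta * gap g -> 2 * eps <= beta * gap g' ->
      (g < g')%N -> exists2 q, pole bs q & u g + t i < q < u g' + t i.
    move=> rg rg' gg'; have [_ [b bbs [m mP]]] := pP g.+1 (ltn_ord g).
    have b0 := bs0 _ bbs; have [_ /(_ _ bbs)[mt mtP]] := tP i.
    exists ((m + mt)%:~R / b).
      by exists b => //; exists (m + mt); rewrite divfK ?gt_eqF.
    have eb : beta * (2 * e / b) <= eps.
      have -> : beta * (2 * e / b) = eps * (b^-1 / c1) by rewrite /e; field; rewrite !gt_eqF.
      by rewrite ler_piMr ?(ltW eps0) // ler_pdivrMr // mul1r c1P.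
    have gapE (x : 'I_n) : 2 * eps <= beta * gap x -> 4 * e / b <= gap x.
      move=> h1; rewrite -(ler_pM2l beta0); apply: le_trans h1.
      rewrite (_ : beta * (4 * e / b) = 2 * (beta * (2 * e / b))); last by ring.
      by rewrite ler_pM2l.
    have qE : (m + mt)%:~R / b = p g.+1 + t i - (b * t i - mt%:~R) / b.
      by rewrite intrD -mP; field; rewrite gt_eqF.
    have : `|(b * t i - mt%:~R) / b| <= e / b.
      by rewrite normrM [ `|b^-1| ]gtr0_norm ?invr_gt0 // ler_pM2r ?invr_gt0.
    rewrite ler_norml => /andP[h1 h2]; have := gapE _ rg; have := gapE _ rg'.
    have eb0 : 0 < e / b by rewrite divr_gt0.
    have pg : p g.+1 <= p g' by apply: pmono; rewrite gg' ltnW.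
    rewrite qE /u /gap; move: h1 h2 eb0; lra.
  move=> [g j] [g' j'] /= ne; have [rg _] := jP g j; have [rg' _] := jP g' j'.
  have [jj|jj|jj] := ltngtP (nat_of_ord j) (nat_of_ord j').
  - by have [q pq qP] := far g g' j.+1 j'.+1 jj; exists q => //; left.
  - by have [q pq qP] := far g' g j'.+1 j.+1 jj; exists q => //; right.
  rewrite jj; have [gg|gg|gg] := ltngtP g g'.
  - by have [q pq qP] := near_ g g' j'.+1 rg rg' gg; exists q => //; left.
  - by have [q pq qP] := near_ g' g j'.+1 rg' rg gg; exists q => //; right.
  have {}gg : g = g' by apply: val_inj.
  subst g'; case/eqP: ne; congr (Tagged _ _); exact: val_inj.
Qed.

End Counting.

(** * The counting rate and its error constant *)

Section CountingConstant.
Context {R : realType}.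
Implicit Types (bs : seq R) (a b T : R).

Lemma has_good_points_le bs (beta Q Q' : R) :
  Q' <= Q -> has_good_points bs beta Q -> has_good_points bs beta Q'.
Proof.
move=> QQ [K H]; exists K => T T0; have [I [v [h1 h2 h3 h4]]] := H T T0.
exists I, v; split => //; apply: le_trans h1; rewrite lerD2r ler_pM2r ?ler_wpM2r //.
by rewrite invr_gt0 mulr_gt0 // pi_gt0.
Qed.

(** The linear minorant only yields rates strictly below [b], and the rate [b] itself is needed when
    [b] is the smallest singular value. The midpoints are explicit here and the squared sine is 1 at
    each; the offset [3 / 2] leaves the pole [1 / b] below them. *)
Lemma has_good_points1 b : 0 < b -> has_good_points [:: b] b b.
Proof.
move=> b0; have p0 := @pi_gt0 R; exists 3 => T T0.
pose w := b * T / (2 * pi); have w0 : 0 <= w.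
  by rewrite divr_ge0 ?mulr_ge0 // ltW.
pose N := (Num.truncn w - 2)%N.
exists ('I_N : finType), (fun j : 'I_N => (j%:R + 3 / 2) / b).
have polem (m : int) : pole [:: b] (m%:~R / b).
  by exists b; rewrite ?mem_head //; exists m; rewrite divfK ?gt_eqF.
split.
- rewrite card_ord -/w /N; have /andP[_] := truncn_itv w0.
  rewrite -natr1; have [h2|h2] := leqP 2 (Num.truncn w).
    by rewrite natrB //; lra.
  have -> : (Num.truncn w - 2 = 0)%N by apply/eqP; rewrite subn_eq0 ltnW.
  have : (Num.truncn w)%:R <= 1 :> R by rewrite -[1]/(1%:R) ler_nat -ltnS.
  by lra.
- move=> i; exists (1%:~R / b) => //; rewrite divr_gt0 //= ltr_pM2r ?invr_gt0 //.
  by have : 0 <= i%:R :> R by []; lra.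
- move=> i _ /[1!inE] /eqP ->.
  have -> : b * ((i%:R + 3 / 2) / b) * pi = (pi / 2) + (i.+1)%:~R * pi.
    rewrite mulrCA mulfV ?gt_eqF // mulr1 -[i.+1%:~R]/(i.+1%:R) -natr1.
    by move: (pi) => c; field.
  rewrite sin_int_shift sin_pihalf expr1n mulr1.
  have iw : i.+3%:R <= w.
    by rewrite -truncn_gt_nat; have := ltn_ord i; rewrite {2}/N ltn_subRL add2n.
  rewrite (_ : b * _ = b * (2 * pi * (i%:R + 3 / 2) + 1)); last first.
    by move: (pi) => c; field; rewrite gt_eqF.
  rewrite expr2 -[ltRHS]mulrA ltr_pM2l //.
  move: iw; rewrite /w ler_pdivlMr ?mulr_gt0 // -3!natr1.
  have := @pi_ge2 R; nra.
- move=> i j; have far (k l : 'I_N) : (k < l)%N ->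
      exists2 p, pole [:: b] p & (k%:R + 3 / 2) / b < p < (l%:R + 3 / 2) / b.
    move=> kl; exists ((Posz k.+2)%:~R / b) => //.
    rewrite !ltr_pM2r ?invr_gt0 // -[k.+2%:~R]/(k.+2%:R).
    have : k.+1%:R <= l%:R :> R by rewrite ler_nat.
    by rewrite -2!natr1; lra.
  move=> ne; have [kl|kl|kl] := ltngtP i j; last by case/eqP: ne; exact: val_inj.
  - by have [p pp pP] := far _ _ kl; exists p => //; left.
  - by have [p pp pP] := far _ _ kl; exists p => //; right.
Qed.

(** For [y >= 1] the integer part is at least 1 and exceeds [y - 1], hence exceeds [y / 2]. *)
Lemma floor_ratio_bounds a b : 0 < a -> a <= b ->
  2^-1 <= a / b * (Num.floor (b / a))%:~R <= 1.
Proof.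
move=> a0 ab; have b0 := lt_le_trans a0 ab.
have ba1 : 1 <= b / a by rewrite ler_pdivlMr // mul1r.
have f1 : 1 <= (Num.floor (b / a))%:~R :> R.
  by rewrite -[1]/(1%:~R) ler_int -floor_gt0 in ba1 *.
have f2 := floorD1_gt (b / a); rewrite intrD in f2; have f3 := floor_le (b / a).
have baE : a / b * (b / a) = 1 by field; rewrite !gt_eqF.
have ab0 : 0 < a / b by rewrite divr_gt0.
rewrite -(ler_pM2l ab0) in f1; rewrite -(ltr_pM2l ab0) in f2; rewrite -(ler_pM2l ab0) in f3.
by move: f1 f2 f3 baE; nra.
Qed.

(* [sin^2 (delta' pi / 2)], except for a single frequency, where [delta'] may exceed 1. *)
Definition count_rate bs a : R :=
  if size bs == 1%N then 1 else
  sin ((\sum_(b <- bs) a / b * (Num.floor (b / a))%:~R)^-1 * pi / 2) ^+ 2.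

(** The minorant is chosen here. The terms of [X] are at least [1/2] and at least [a / beta], so
    [d = 1 / X] satisfies [d n <= 2] and [a d n <= beta]; moreover [S < beta n], because at least
    two distinct frequencies occur. These three bounds settle every case. *)
Lemma has_good_points_rate bs (a beta : R) : uniq bs -> 0 < a -> beta \in bs ->
  (forall b, b \in bs -> a <= b <= beta) ->
  has_good_points bs beta (a * count_rate bs a).
Proof.
move=> ubs a0 betabs bsP.
have bs0 b : b \in bs -> 0 < b by move=> /bsP/andP[/(lt_le_trans a0)].
have beta0 := bs0 _ betabs; have p0 := @pi_gt0 R.
rewrite /count_rate; have [s1|s1] := eqVneq (size bs) 1%N.
  case: bs s1 betabs bsP {ubs bs0} => [//|b []] // _ /[1!inE] /eqP <- bsP.
  rewrite mulr1; have /andP[ab _] := bsP _ (mem_head _ _).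
  exact: has_good_points_le ab (has_good_points1 beta0).
set S := \sum_(b <- bs) b; set X := \sum_(b <- bs) _; set n : R := (size bs)%:R.
have termP b : b \in bs -> 2^-1 <= a / b * (Num.floor (b / a))%:~R /\
     a / beta <= a / b * (Num.floor (b / a))%:~R.
  move=> bbs; have b0 := bs0 _ bbs; have /andP[ab bbeta] := bsP _ bbs.
  have ba1 : 1 <= b / a by rewrite ler_pdivlMr // mul1r.
  have f1 : 1 <= (Num.floor (b / a))%:~R :> R.
    by rewrite -[1]/(1%:~R) ler_int -floor_gt0 in ba1 *.
  have ab0 : 0 < a / b by rewrite divr_gt0.
  split; first by have /andP[] := floor_ratio_bounds a0 ab.
  apply: (@le_trans _ _ (a / b)); last by rewrite ler_peMr // ltW.
  by rewrite ler_pM2l // lef_pV2.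
have betan : 0 < a / beta by rewrite divr_gt0.
have sumc (c : R) : \sum_(b <- bs) c = c * n.
  by rewrite big_const_seq count_predT iter_addr_0 mulr_natr.
have X1 : 2^-1 * n <= X.
  by rewrite -sumc /X big_seq [leRHS]big_seq; apply: ler_sum => b /termP[].
have X2 : a / beta * n <= X.
  by rewrite -sumc /X big_seq [leRHS]big_seq; apply: ler_sum => b /termP[].
have n2 : (2 <= size bs)%N by case: bs betabs s1 {ubs bsP bs0 S X n termP sumc X1 X2} => [|x []].
have n2R : 2 <= n by rewrite /n ler_nat.
have X0 : 0 < X by apply: lt_le_trans X1; lra.
have S0 : 0 < S.
  rewrite /S (big_rem beta) //= ltr_wpDr // big_seq sumr_ge0 // => b.
  by move=> /mem_rem/bs0/ltW.
have Sn : S < beta * n.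
  have [c cbs cne] : exists2 c, c \in bs & c != beta.
    case: bs ubs n2 {s1 betabs bsP bs0 S X n termP sumc X1 X2 n2R X0 S0} => [//|x [//|y s]].
    rewrite /= inE negb_or => /andP[/andP[xy _] _] _.
    have [xb|xb] := eqVneq x beta; last by exists x; rewrite ?mem_head.
    by exists y; rewrite ?inE ?eqxx ?orbT // -xb eq_sym.
  rewrite /S -sumc (big_rem c) //= [ltRHS](big_rem c) //=; apply: ltr_leD.
    by rewrite lt_neqAle cne; have /andP[] := bsP _ cbs.
  rewrite big_seq [leRHS]big_seq; apply: ler_sum => b /mem_rem/bsP.
  by case/andP.
set d := X^-1; have d0 : 0 < d by rewrite invr_gt0.
have dX : d * X = 1 by rewrite mulVf // gt_eqF.
have d1 : d * n <= 2 by have := ler_wpM2l (ltW d0) X1; rewrite dX; lra.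
have d2 : a * (d * n) <= beta.
  have := ler_wpM2l (ltW d0) X2; rewrite dX -(ler_pM2l beta0) mulr1.
  by rewrite (_ : _ * (_ * _) = a * (d * n)) //; field; rewrite gt_eqF.
have f0 : 0 <= a * sin (d * pi / 2) ^+ 2 by rewrite mulr_ge0 ?sqr_ge0 ?ltW.
have d01 : d <= 1 by nra.
have bsP' b : b \in bs -> 0 < b <= beta by move=> /[dup]/bs0 -> /bsP/andP[].
have [dh|dh] := leP d 2^-1.
  (* The mean of [beta * gap] over a long block. The tangent to [l^2] at this point gives the rate
     [beta^2 / S], which exceeds [beta / n >= a d]. *)
  pose mu := beta / S.
  have mu0 : 0 < mu by rewrite divr_gt0.
  have mu1 : mu <= 1.
    rewrite /mu ler_pdivrMr // mul1r /S (big_rem beta) //= lerDl big_seq sumr_ge0 // => b.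
    by move=> /mem_rem/bs0/ltW.
  apply: (@good_points _ _ _ (2 * mu) (mu ^+ 2)) => //.
  - by lra.
  - by rewrite sqr_ge0.
  - move=> l l01; apply: le_trans (sinsq_ge_sqr l01).
    by have := sqr_ge0 (l - mu); rewrite sqrrB; lra.
  rewrite f0 /=; apply: (@le_lt_trans _ _ (a * d)).
    by rewrite ler_pM2l // sinsq_le_id // dh ltW.
  rewrite -/S (_ : 2 * mu * beta - mu ^+ 2 * S = beta ^+ 2 / S); last first.
    by rewrite /mu; field; rewrite gt_eqF.
  rewrite ltr_pdivlMr //; apply: (@lt_le_trans _ _ (a * d * (beta * n))).
    by rewrite ltr_pM2l // mulr_gt0.
  by rewrite (_ : _ * _ = a * (d * n) * beta) ?expr2 ?ler_pM2r //; ring.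
(* From [d > 1/2] and [d n <= 2] only [n = 2] and [n = 3] remain. The line gives a rate above
   [beta (6 - n) / 5], compared with [a sin^2 (d pi / 2)] by means of [beta >= a d n]. *)
apply: (@good_points _ _ _ (6 / 5) 5^-1) => //; first by lra.
  exact: sinsq_ge_line.
rewrite f0 -/S /=.
have n4 : n < 4 by nra.
have {n4} : (size bs < 4)%N by rewrite -(ltr_nat R).
rewrite leq_eqVlt => /orP[/eqP [] s3|s3].
  have nE : n = 3 by rewrite /n s3.
  rewrite nE in d1 d2 Sn; have : a * sin (d * pi / 2) ^+ 2 <= a * (7 / 9).
    by rewrite ler_pM2l // sinsq_le_two_thirds ?(ltW d0) //; lra.
  have : a * 2^-1 < a * d by rewrite ltr_pM2l.
  by lra.
have nE : n = 2 by rewrite /n; congr (_%:R); apply/eqP; rewrite eqn_leq n2 andbT -ltnS.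
rewrite nE in d1 d2 Sn; have [dt|dt] := leP d (2 / 3).
  have : a * sin (d * pi / 2) ^+ 2 <= a * (7 / 9).
    by rewrite ler_pM2l // sinsq_le_two_thirds ?(ltW d0) //.
  have : a * 2^-1 < a * d by rewrite ltr_pM2l.
  by lra.
have : a * sin (d * pi / 2) ^+ 2 <= a * 1 by rewrite ler_pM2l // sinsq_le1.
have : a * (2 / 3) < a * d by rewrite ltr_pM2l.
by lra.
Qed.

(** Every term of the sum is at most 1, so the sum is at most [k]. With two or more terms it is at
    least 1, which keeps its inverse in the range where the squared sine increases. *)
Lemma count_rate_ge bs a (k : nat) : 0 < a -> (forall b, b \in bs -> a <= b) ->
  bs != [::] -> (size bs <= k)%N -> sin (k%:R^-1 * pi / 2) ^+ 2 <= count_rate bs a.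
Proof.
move=> a0 bsP bs0 bsk; rewrite /count_rate; case: ifPn => s1; first exact: sinsq_le1.
set X := \sum_(b <- bs) _.
have sz2 : (1 < size bs)%N by case: bs s1 bs0 {bsP bsk X} => [|x []].
have sumc (c : R) : \sum_(b <- bs) c = c * (size bs)%:R.
  by rewrite big_const_seq count_predT iter_addr_0 mulr_natr.
have X1 : 2^-1 * (size bs)%:R <= X.
  rewrite -sumc /X big_seq [leRHS]big_seq; apply: ler_sum => b /bsP ab.
  by have /andP[] := floor_ratio_bounds a0 ab.
have X2 : X <= 1 * (size bs)%:R.
  rewrite -sumc /X big_seq [leRHS]big_seq; apply: ler_sum => b /bsP ab.
  by have /andP[] := floor_ratio_bounds a0 ab.
have n2 : 2 <= (size bs)%:R :> R by rewrite ler_nat.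
have nk : (size bs)%:R <= k%:R :> R by rewrite ler_nat.
have Xge1 : 1 <= X by lra.
apply: sinsq_mono; first by rewrite invr_ge0.
  by rewrite lef_pV2 ?posrE; lra.
by rewrite invf_le1 //; lra.
Qed.

(** Dilating the frequencies by [l] divides the points by [l] and replaces [T] by [l T]. That [K]
    stays the same is what makes the additive constant homogeneous of degree 0. *)
Lemma good_points_scale (K l : R) bs beta Q : 0 < l ->
  good_points_bound K bs beta Q ->
  good_points_bound K [seq l * b | b <- bs] (l * beta) (l * Q).
Proof.
move=> l0 H T T0; have ln0 : l != 0 by rewrite gt_eqF.
have [I [v [h1 h2 h3 h4]]] := H (l * T) (mulr_ge0 (ltW l0) T0).
have poleZ p : pole bs p -> pole [seq l * b | b <- bs] (p / l).
  case=> b bbs [m mE]; exists (l * b); first exact: map_f.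
  by exists m; rewrite -mE mulrA divfK.
have li0 : 0 < l^-1 by rewrite invr_gt0.
exists I, (fun i => v i / l); split.
- apply: le_trans h1; rewrite (_ : l * Q * T = Q * (l * T)) //; ring.
- move=> i; have [p pp pP] := h2 i; exists (p / l); first exact: poleZ.
  by rewrite divr_gt0 ?ltr_pM2r //; case/andP: pP.
- move=> i _ /mapP[b bbs ->]; have := h3 i b bbs; rewrite -(ltr_pM2l l0).
  rewrite (_ : l * b * (v i / l) = b * v i); last by field.
  rewrite (_ : l * (b * _) = l * b * (2 * pi * (v i / l) * (l * b) + 1)); last first.
    by move: (pi) => c; field.
  move=> /lt_le_trans; apply; rewrite le_eqVlt; apply/orP; left; apply/eqP; ring.
- move=> i j /h4[p pp pP]; exists (p / l); first exact: poleZ.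
  by rewrite !ltr_pM2r.
Qed.

Lemma count_rate_scale (l a : R) bs : l != 0 ->
  count_rate [seq l * b | b <- bs] (l * a) = count_rate bs a.
Proof.
move=> l0; rewrite /count_rate size_map; case: ifP => // _.
congr (sin (_^-1 * _ / _) ^+ 2); rewrite big_map; apply: eq_bigr => b _.
by rewrite -!mulf_div divff // !mul1r.
Qed.

(** Chosen from the list of frequencies alone, so that the additive constant depends on neither the
    group nor the point. Nonnegativity is imposed so that a sum of such constants dominates each of
    them. *)
Definition gap_const bs : R :=
  xget 0 [set K | 0 <= K /\ good_points_bound K bs (last 0 bs) (count_rate bs 1)].

Lemma gap_const_ge0 bs : 0 <= gap_const bs.
Proof. by rewrite /gap_const; case: xgetP => [K -> []|]. Qed.

Lemma sorted_last bs : sorted <%R bs -> bs != [::] ->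
  last 0 bs \in bs /\ forall b, b \in bs -> b <= last 0 bs.
Proof.
case/lastP: bs => // s x; rewrite last_rcons mem_rcons mem_head => ss _; split=> // b.
rewrite mem_rcons inE => /orP[/eqP -> //|bs].
move: ss; rewrite (sorted_pairwise lt_trans) pairwise_rcons => /andP[/allP/(_ _ bs) + _].
exact: ltW.
Qed.

Lemma gap_constP bs : sorted <%R bs -> bs != [::] -> (forall b, b \in bs -> 1 <= b) ->
  good_points_bound (gap_const bs) bs (last 0 bs) (count_rate bs 1).
Proof.
move=> sbs bs0 bs1; have [lastbs lastP] := sorted_last sbs bs0.
have bsP b : b \in bs -> 1 <= b <= last 0 bs by move=> bbs; rewrite bs1 //= lastP.
have [K KP] := has_good_points_rate (lt_sorted_uniq sbs) ltr01 lastbs bsP.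
rewrite mul1r in KP.
pose S := [set K | 0 <= K /\ good_points_bound K bs (last 0 bs) (count_rate bs 1)].
suff ex : exists K, S K by have [] := xgetPex 0 ex.
exists (Num.max K 0); split; first by rewrite le_max lexx orbT.
move=> T T0; have [I [v [h1 h2 h3 h4]]] := KP T T0; exists I, v; split => //.
by apply: le_trans h1; rewrite lerD2l lerN2 le_max lexx.
Qed.

End CountingConstant.

(** * Path components and the total Betti number *)

Section PathComponents.
Context {R : realType} {T : topologicalType}.

Definition simplex0_pt : std_simplex R 0.
Proof.
exists (const_mx 1); apply/mem_set; split.
  by move=> i; rewrite mxE.
by rewrite big_ord1 mxE.
Defined.

Lemma point_continuous (x : T) :
  (fun=> x) \in [set f : std_simplex R 0 -> T | continuous f].
Proof. by apply/mem_set => t; exact: cst_continuous. Qed.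

Definition point_simplex (x : T) : sing R T 0 := exist _ (fun=> x) (point_continuous x).

Definition simplex_pt (s : sing R T 0) : T := \val s simplex0_pt.

(** Clamping extends the parametrisation of the 1-simplex by [[0, 1]] to a continuous map on the
    whole line. *)
Definition clamp01 (x : R) : R := Num.max 0 (Num.min 1 x).

Lemma clamp01P (x : R) : 0 <= clamp01 x <= 1.
Proof. by rewrite /clamp01 le_max lexx ge_max ler01 ge_min lexx. Qed.

Definition edge_row (x : R) : 'rV[R]_2 :=
  \row_j (if j == ord0 then 1 - clamp01 x else clamp01 x).

Lemma edge_row_simplex (x : R) : edge_row x \in std_simplex R 1.
Proof.
have /andP[x0 x1] := clamp01P x; apply/mem_set; split.
  by move=> i; rewrite mxE; case: ifP; rewrite ?subr_ge0.
by rewrite big_ord_recl big_ord1 !mxE /= subrK.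
Qed.

Definition edge (x : R) : std_simplex R 1 := exist _ (edge_row x) (edge_row_simplex x).

Lemma clamp01_lip (x y : R) : `|clamp01 x - clamp01 y| <= `|x - y|.
Proof.
rewrite /clamp01 /Num.max /Num.min; do !case: ifP; rewrite ler_norml;
  have := ler_norm (x - y); have := ler_norm (y - x); rewrite (distrC y x).
all: move=> h1 h2; do ?[move=> /idP|move=> /negP/negP; rewrite -leNgt] => *; lra.
Qed.

Lemma edge_continuous : continuous edge.
Proof.
apply: (@continuous_comp_initial _ R _ set_val).
move=> x /= U /(nbhs_ballP (edge_row x)) [e e0 eU].
apply/nbhs_ballP; exists e => //= y xy; apply: eU; split => // a b; rewrite !mxE.
have h : `|clamp01 x - clamp01 y| < e by apply: le_lt_trans (clamp01_lip x y) _.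
case: ifP => _; rewrite /ball /=; last exact: h.
rewrite (_ : _ - _ = - (clamp01 x - clamp01 y)) ?normrN //; ring.
Qed.

Lemma face0_edge : face_map ord0 simplex0_pt = edge 1.
Proof.
apply: val_inj => /=; apply/rowP => j; rewrite !mxE /clamp01 /Num.min ltxx.
rewrite /Num.max ltr01; case: unliftP => [l ->|->].
  by rewrite mxE.
by rewrite eqxx subrr.
Qed.

Lemma face1_edge : face_map ord_max simplex0_pt = edge 0.
Proof.
apply: val_inj => /=; apply/rowP => j; rewrite !mxE /clamp01 /Num.min ltr10 /=.
rewrite /Num.max ltxx subr0; case: unliftP => [l ->|->].
  by rewrite mxE (ord1 l).
by [].
Qed.

Lemma ivt_edge (phi : T -> R) (u : sing R T 1) (s : R) : continuous phi ->
  let y0 := simplex_pt (face ord0 u) in let y1 := simplex_pt (face ord_max u) in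
  phi y0 <= s <= phi y1 \/ phi y1 <= s <= phi y0 -> exists y, phi y = s.
Proof.
move=> cphi y0 y1 hs; have cu : continuous (\val u) by exact: (set_mem (valP u)).
pose g x := phi (\val u (edge x)).
have cg : {within `[0, 1], continuous g}.
  apply: continuous_subspaceT => x; rewrite /g.
  apply: (@continuous_comp _ _ _ (\val u \o edge) phi); last exact: cphi.
  by apply: continuous_comp; [exact: edge_continuous | exact: cu].
have g1 : g 1 = phi y0 by rewrite /g -face0_edge.
have g0 : g 0 = phi y1 by rewrite /g -face1_edge.
have [|c _ gc] := @IVT _ g 0 1 s ler01 cg; last by exists (\val u (edge c)).
by rewrite g0 g1 ge_min le_max; case: hs => /andP[-> ->]; rewrite ?orbT.
Qed.

Lemma boundary0E (d : sing R T 1 -> int) (ds : seq (sing R T 1)) s : uniq ds ->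
  (forall u, d u != 0 -> u \in ds) ->
  boundary d s = \sum_(u <- ds) d u * ((face ord0 u == s)%:R - (face ord_max u == s)%:R).
Proof.
move=> uds dsP; have E (i : 'I_2) : \sum_(u \in [set u | face i u = s]) d u =
    \sum_(u <- ds) d u * (face i u == s)%:R.
  rewrite (_ : [set u | _] = [set` (fun u => face i u == s)]); last first.
    by apply/seteqP; split=> u /= /eqP.
  rewrite -(@bigfs _ _ _ _ ds) //; last first.
    by move=> u _ uds'; apply/eqP; apply: contraNT uds' => /dsP.
  by rewrite big_mkcond; apply: eq_bigr => u _; case: eqP; rewrite ?mulr1 ?mulr0.
rewrite /boundary big_ord_recl big_ord1 !E expr0 mul1r expr1 mulN1r -sumrB.
apply: eq_bigr => u _; rewrite -mulrBr; congr (_ * (_ - (face _ _ == _)%:R)).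
exact: val_inj.
Qed.

Lemma sum_delta (Z : eqType) (zs : seq Z) z (F : Z -> int) : uniq zs -> z \in zs ->
  \sum_(s <- zs) F s * (z == s)%:R = F z.
Proof.
move=> uzs zzs; rewrite (bigD1_seq z) //= eqxx mulr1 big1 ?addr0 // => s.
by rewrite eq_sym => /negbTE ->; rewrite mulr0.
Qed.

Lemma between_split (x y z s : R) : x <= s <= z \/ z <= s <= x ->
  (x <= s <= y \/ y <= s <= x) \/ (y <= s <= z \/ z <= s <= y).
Proof.
move=> [] /andP[h1 h2]; case/orP: (le_total y s) => h.
- by right; left; rewrite h.
- by left; left; rewrite h1.
- by left; right; rewrite h.
- by right; right; rewrite h1.
Qed.

(** A cocycle argument: [X] is the indicator of the points [y] such that [phi] attains every value
    between [x0] and [phi y]. By the intermediate value theorem [X] agrees at the two ends of a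
    singular edge, so it vanishes on boundaries; on the given points it is the delta function at
    [i0]. Pairing a bounding combination with [X] isolates the coefficient [a i0]. *)
Lemma homology_rank0_ge (phi : T -> R) (I : finType) (t : I -> T) : continuous phi ->
  (forall i j, i != j -> exists2 s, (forall y, phi y <> s) &
    phi (t i) < s < phi (t j) \/ phi (t j) < s < phi (t i)) ->
  (#|I|%:R%:E <= homology_rank R T 0)%E.
Proof.
move=> cphi sep; apply: ereal_sup_ubound; exists #|I| => //.
pose pt (i : 'I_#|I|) := point_simplex (t (enum_val i)) : sing R T 0.
exists (fun i s => (pt i == s)%:R : int); split.
  move=> i; apply: (@sub_finite_set _ _ [set pt i]) => // s /=.
  by have [->|] := eqVneq (pt i) s.
move=> a [d /finite_seqP[ds0 ds0E] dE] i0; pose ds := undup ds0.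
have uds : uniq ds by exact: undup_uniq.
have dsP u : d u != 0 -> u \in ds.
  by move=> du; rewrite mem_undup; have : [set s | d s != 0] u by []; rewrite ds0E.
pose x0 := phi (t (enum_val i0)).
pose linked y := forall s, x0 <= s <= phi y \/ phi y <= s <= x0 -> exists y', phi y' = s.
pose X (s : sing R T 0) : int := (`[< linked (simplex_pt s) >])%:R.
(* A finite list of all 0-simplices involved, so that the pairing with [X] is a finite sum that can
   be exchanged with the others. *)
pose zs := undup ([seq pt i | i <- enum 'I_#|I|] ++ [seq face ord0 u | u <- ds]
  ++ [seq face ord_max u | u <- ds]).
have uzs : uniq zs by apply: undup_uniq.
have Xpt i : X (pt i) = (i == i0)%:R.
  rewrite /X; have [->|ne] := eqVneq i i0.
    rewrite asboolT // => s [] /andP[h1 h2]; exists (t (enum_val i0));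
      by apply/eqP; rewrite eq_le h1 h2.
  rewrite asboolF // => h; have [|s sN hs] := sep (enum_val i) (enum_val i0).
    by apply: contra ne => /eqP/enum_val_inj ->.
  have [|y] := h s; last exact: sN.
  by case: hs => /andP[h1 h2]; [right | left]; rewrite !ltW.
have Xface u : X (face ord0 u) = X (face ord_max u).
  rewrite /X; congr (_%:R); congr (nat_of_bool _); apply: asbool_equiv_eq.
  set y0 := simplex_pt _; set y1 := simplex_pt _.
  have fill s : phi y0 <= s <= phi y1 \/ phi y1 <= s <= phi y0 -> exists y, phi y = s.
    exact: ivt_edge.
  split=> h s hs.
    by have [/h|h1] := between_split (phi y0) hs; last by apply: fill.
  by have [/h|h1] := between_split (phi y1) hs; last by apply: fill; tauto.
have ptzs i : pt i \in zs by rewrite mem_undup mem_cat map_f // mem_enum.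
have aX i : \sum_(s <- zs) X s * (a i * (pt i == s)%:R) = a i * X (pt i).
  by rewrite -(sum_delta X uzs (ptzs i)) mulr_sumr; apply: eq_bigr => s _; rewrite mulrCA.
have : \sum_(s <- zs) X s * (\sum_i a i * (pt i == s)%:R) = a i0.
  under eq_bigr do rewrite mulr_sumr.
  rewrite exchange_big /= (eq_bigr _ (fun i _ => aX i)) (bigD1 i0) //=.
  by rewrite Xpt eqxx mulr1 big1 ?addr0 // => i ne; rewrite Xpt (negbTE ne) mulr0.
move=> <-; under eq_bigr do rewrite dE (boundary0E _ uds dsP) mulr_sumr.
rewrite exchange_big big1_seq //= => u uds'.
have f0 : face ord0 u \in zs by rewrite mem_undup !mem_cat (map_f (face ord0) uds') orbT.
have f1 : face ord_max u \in zs.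
  by rewrite mem_undup !mem_cat (map_f (face ord_max) uds') !orbT.
under eq_bigr do rewrite mulrCA mulrBr.
by rewrite -mulr_sumr sumrB !sum_delta // Xface subrr mulr0.
Qed.

Lemma homology_rank_ge0 k : (0 <= homology_rank R T k)%E.
Proof.
apply: ereal_sup_ubound; exists 0%N => //=.
by exists (fun i _ => 0); split=> [|a _] [].
Qed.

Lemma total_betti_ge (phi : T -> R) (I : finType) (t : I -> T) : continuous phi ->
  (forall i j, i != j -> exists2 s, (forall y, phi y <> s) &
    phi (t i) < s < phi (t j) \/ phi (t j) < s < phi (t i)) ->
  (#|I|%:R%:E <= total_betti R T)%E.
Proof.
move=> cphi sep; apply: le_trans (homology_rank0_ge cphi sep) _.
have := @nneseries_lim_ge R (fun k => homology_rank R T k) xpredT 0%N 1%N.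
rewrite big_nat1; apply => n _ _; exact: homology_rank_ge0.
Qed.

Lemma total_betti_ge0 : (0 <= total_betti R T)%E.
Proof. by apply: nneseries_ge0 => n _ _; exact: homology_rank_ge0. Qed.

End PathComponents.

(** * Singular planes of a skew-symmetric matrix *)

Section Spectral.
Context {R : realType}.

(** Over the complex numbers the spectral theorem for Hermitian matrices makes the minimal
    polynomial divide a product of distinct linear factors with real roots. This divisibility
    descends to the reals and gives diagonalisability there. *)
Lemma symmetric_eigenspaces n (B : 'M[R]_n) : B^T = B ->
  exists rs, (\sum_(r <- rs) eigenspace B r :=: 1%:M)%MS.
Proof.
case: n B => [|n] B Bsym.
  by exists [::]; rewrite big_nil; apply/eqmxP; rewrite sub0mx !thinmx0 sub0mx.
pose C := (complex.complex R : numClosedFieldType).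
pose f : {rmorphism R -> C} := complex.real_complex R.
pose BC := map_mx f B.
have fR x : f x \is Num.real by apply/complex.complex_realP; exists x.
have BCh : BC \is hermsymmx.
  apply: realsym_hermsym.
    by apply/is_hermitianmxP; rewrite expr0 scale1r map_mx_id // /BC map_trmx Bsym.
  by apply/mxOverP => i j; rewrite mxE.
have /orthomx_spectralP BCE := hermitian_normalmx BCh.
have dR := hermitian_spectral_diag_real BCh.
pose rs := [seq complex.Re (spectral_diag BC ord0 i) | i <- enum 'I_n.+1].
have dE i : spectral_diag BC ord0 i = f (complex.Re (spectral_diag BC ord0 i)).
  by have /mxOverP/(_ ord0 i)/complex.complex_realP[k ->] := dR.
have minB : mxminpoly B %| \prod_(x <- undup rs) ('X - x%:P).
  rewrite -(dvdp_map f) -mxminpoly_map -/BC BCE.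
  rewrite -(conjVmx _ (spectral_unit _)) mxminpoly_uconj ?unitmx_inv ?spectral_unit //.
  rewrite mxminpoly_diag rmorph_prod /=.
  rewrite (eq_bigr (fun x => 'X - (f x)%:P)); last first.
    by move=> x _; rewrite rmorphB /= map_polyX map_polyC.
  rewrite -(big_map f xpredT (fun y => 'X - y%:P)).
  rewrite -undup_map_inj; last exact: complex.complexI.
  rewrite (_ : [seq f i | i <- rs] = [seq spectral_diag BC 0 i | i <- enum 'I_n.+1]) //.
  by rewrite /rs -map_comp; apply: eq_map => i /=; rewrite -dE.
have /diagonalizablePeigen[rs' _ h] : diagonalizable B.
  by apply/diagonalizableP; exists (undup rs); rewrite ?undup_uniq.
by exists rs'.
Qed.

End Spectral.

Section Dot.
Context {R : realType} {m : nat}.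
Implicit Types (u v w : 'rV[R]_m) (M : 'M[R]_m).

Definition dot u v : R := \sum_i u ord0 i * v ord0 i.

Lemma dotE u v : dot u v = (u *m v^T) ord0 ord0.
Proof. by rewrite mxE; apply: eq_bigr => i _; rewrite !mxE. Qed.

Lemma dotC u v : dot u v = dot v u.
Proof. by apply: eq_bigr => i _; rewrite mulrC. Qed.

Lemma dotDl u v w : dot (u + v) w = dot u w + dot v w.
Proof. by rewrite !dotE mulmxDl mxE. Qed.

Lemma dotZl c u w : dot (c *: u) w = c * dot u w.
Proof. by rewrite !dotE -scalemxAl mxE. Qed.

Lemma dotNl u w : dot (- u) w = - dot u w.
Proof. by rewrite !dotE mulNmx mxE. Qed.

Lemma dotDr u v w : dot w (u + v) = dot w u + dot w v.
Proof. by rewrite !(dotC w) dotDl. Qed.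

Lemma dotZr c u w : dot w (c *: u) = c * dot w u.
Proof. by rewrite !(dotC w) dotZl. Qed.

Lemma dotNr u w : dot w (- u) = - dot w u.
Proof. by rewrite !(dotC w) dotNl. Qed.

Lemma dot0l u : dot 0 u = 0.
Proof. by rewrite dotE mul0mx mxE. Qed.

Lemma dot0r u : dot u 0 = 0.
Proof. by rewrite dotC dot0l. Qed.

Lemma dot_suml (T : Type) (s : seq T) (F : T -> 'rV[R]_m) w :
  dot (\sum_(a <- s) F a) w = \sum_(a <- s) dot (F a) w.
Proof.
by apply: (big_ind2 (fun u (r : R) => dot u w = r)); rewrite ?dot0l // => u r u' r' <- <-;
  rewrite dotDl.
Qed.

Lemma dot_sumr (T : Type) (s : seq T) (F : T -> 'rV[R]_m) w :
  dot w (\sum_(a <- s) F a) = \sum_(a <- s) dot w (F a).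
Proof. by rewrite dotC dot_suml; apply: eq_bigr => a _; rewrite dotC. Qed.

Lemma dot_delta u i : dot u (delta_mx ord0 i) = u ord0 i.
Proof.
rewrite /dot (bigD1 i) //= mxE !eqxx mulr1 big1 ?addr0 // => j ne.
by rewrite mxE (negbTE ne) andbF mulr0.
Qed.

Lemma dot_mulmx M u v : dot (u *m M) v = dot u (v *m M^T).
Proof. by rewrite !dotE trmx_mul trmxK mulmxA. Qed.

Lemma dot_ge0 u : 0 <= dot u u.
Proof. by apply: sumr_ge0 => i _; rewrite -expr2 sqr_ge0. Qed.

Lemma dot_eq0 u : dot u u = 0 -> u = 0.
Proof.
move=> /eqP; rewrite psumr_eq0 => [/allP h|i _]; last by rewrite -expr2 sqr_ge0.
apply/rowP => i; rewrite mxE; apply/eqP.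
by have := h i (mem_index_enum i); rewrite /= mulf_eq0 orbb.
Qed.

Lemma dot_enorm u : dot u u = enorm u ^+ 2.
Proof.
rewrite sqr_sqrtr; first by apply: eq_bigr => i _; rewrite expr2.
by apply: sumr_ge0 => i _; exact: sqr_ge0.
Qed.

End Dot.

(** * Orthogonal decomposition along the singular values of a skew matrix *)

Section SingularDecomposition.
Context {R : realType} {m : nat} (A : 'M[R]_m) (al : seq R).
Hypotheses (Askew : A^T = - A) (Aunit : A \in unitmx)
  (alP : distinct_singular_values A al).
Implicit Types (u v w x : 'rV[R]_m) (a b : R).

Definition in_plane a w : Prop := w *m A *m A = - (a ^+ 2 *: w).

Lemma dot_skew u v : dot (u *m A) v = - dot u (v *m A).
Proof. by rewrite dot_mulmx Askew mulmxN dotNr. Qed.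

Lemma dot_skew0 u : dot u (u *m A) = 0.
Proof.
apply/eqP; have := dot_skew u u; rewrite dotC => /eqP.
by rewrite -addr_eq0 -mulr2n mulrn_eq0.
Qed.

Lemma in_planeE a w : in_plane a w <-> w *m (A^T *m A) = a ^+ 2 *: w.
Proof.
rewrite /in_plane Askew mulmxA mulmxN mulNmx; split=> [->|<-].
  by rewrite opprK.
by rewrite opprK.
Qed.

Lemma in_plane_mul a w : in_plane a w -> in_plane a (w *m A).
Proof. by move=> h; rewrite /in_plane h mulNmx -scalemxAl. Qed.

Lemma in_planeZ a c w : in_plane a w -> in_plane a (c *: w).
Proof. by move=> h; rewrite /in_plane -!scalemxAl h scalerN !scalerA mulrC. Qed.

Lemma in_planeD a u v : in_plane a u -> in_plane a v -> in_plane a (u + v).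
Proof. by move=> hu hv; rewrite /in_plane !mulmxDl hu hv scalerDr opprD. Qed.

Lemma in_plane_dot_mul a w : in_plane a w -> dot (w *m A) (w *m A) = a ^+ 2 * dot w w.
Proof. by move=> h; rewrite dot_skew h dotNr opprK dotZr. Qed.

Lemma in_plane_orth a b u v : in_plane a u -> in_plane b v -> a ^+ 2 != b ^+ 2 ->
  dot u v = 0.
Proof.
move=> hu hv ab; apply/eqP; have := dot_skew (u *m A) v.
rewrite hu dot_skew hv !dotNr dotNl opprK dotZl dotZr => /eqP.
by rewrite eqr_opp -subr_eq0 -mulrBl mulf_eq0 subr_eq0 (negbTE ab).
Qed.

(** [kermx E^T] is the orthogonal complement of [E], so [sv_proj] is the orthogonal projection. *)
Lemma eigenspace_disjoint (B : 'M[R]_m) r :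
  let E := eigenspace B r in (E :&: kermx E^T = 0)%MS.
Proof.
move=> E; apply/eqP; rewrite -submx0; apply/row_subP => i; rewrite submx0.
set w := row i _; have : (w <= E :&: kermx E^T)%MS by exact: row_sub.
rewrite sub_capmx => /andP[/submxP[c wE] /sub_kermxP wK].
by apply/eqP/dot_eq0; rewrite dotE {2}wE trmx_mul mulmxA wK mul0mx mxE.
Qed.

Lemma sv_proj_in a x : in_plane a (sv_proj A a x).
Proof. by apply/in_planeE/eigenspaceP; exact: proj_mx_sub. Qed.

Lemma sv_proj_id a w : in_plane a w -> sv_proj A a w = w.
Proof.
move=> /in_planeE/eigenspaceP h.
by apply: proj_mx_id => //; exact: eigenspace_disjoint.
Qed.

Lemma sv_proj_orth a b w : in_plane b w -> a ^+ 2 != b ^+ 2 -> sv_proj A a w = 0.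
Proof.
move=> hw ab; apply: proj_mx_0; first exact: eigenspace_disjoint.
apply/sub_kermxP/rowP => i; rewrite !mxE.
have h := @in_plane_orth _ _ _ _ (_ : in_plane a (row i (eigenspace (A^T *m A) (a ^+ 2)))) hw ab.
rewrite -[RHS]h; last by apply/in_planeE/eigenspaceP; exact: row_sub.
by apply: eq_bigr => j _; rewrite !mxE mulrC.
Qed.

Lemma sv_projD a x u : sv_proj A a (x + u) = sv_proj A a x + sv_proj A a u.
Proof. exact: mulmxDl. Qed.

Lemma sv_proj_sum (T : Type) (s : seq T) (F : T -> 'rV[R]_m) a :
  sv_proj A a (\sum_(i <- s) F i) = \sum_(i <- s) sv_proj A a (F i).
Proof. exact: mulmx_suml. Qed.

Lemma al_gt0 a : a \in al -> 0 < a.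
Proof.
case: alP => _ ->; rewrite /singular_value => /andP[a0 /eigenvalueP[w /in_planeE wE w0]].
rewrite lt_neqAle a0 andbT; apply: contra w0 => /eqP a00.
move: wE; rewrite /in_plane -a00 expr0n /= scale0r oppr0 => h.
by rewrite -[w](mulmxK Aunit) -[w *m A](mulmxK Aunit) h !mul0mx.
Qed.

Lemma al_uniq : uniq al.
Proof. by case: alP => /lt_sorted_uniq. Qed.

Lemma al_sqr a b : a \in al -> b \in al -> (a ^+ 2 == b ^+ 2) = (a == b).
Proof. by move=> /al_gt0/ltW a0 /al_gt0/ltW b0; rewrite eqrXn2. Qed.

(** The eigenspaces of the symmetric matrix [A^T A] span. An eigenvector [v] for [r] satisfies
    [r |v|^2 = |v A|^2], so [r >= 0] and its square root is one of the listed singular values. *)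
Lemma sv_decomp x : x = \sum_(a <- al) sv_proj A a x.
Proof.
have [rs rsP] : exists rs, (\sum_(r <- rs) eigenspace (A^T *m A) r :=: 1%:M)%MS.
  by apply: symmetric_eigenspaces; rewrite trmx_mul trmxK.
have xv r v : (v <= eigenspace (A^T *m A) r)%MS -> v = \sum_(a <- al) sv_proj A a v.
  move=> /eigenspaceP vE; have [->|v0] := eqVneq v 0.
    by rewrite big1 // => a _; rewrite /sv_proj mul0mx.
  have rE : r * dot v v = dot (v *m A) (v *m A).
    by rewrite -dotZl -vE mulmxA dot_mulmx Askew !mulmxN mulNmx dotNl dotNr dotC.
  have vv : 0 < dot v v.
    by rewrite lt_neqAle dot_ge0 andbT eq_sym; apply: contra v0 => /eqP/dot_eq0 ->.
  have r0 : 0 <= r by rewrite -(pmulr_lge0 _ vv) rE dot_ge0.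
  have sqr : Num.sqrt r ^+ 2 = r by exact: sqr_sqrtr.
  have ral : Num.sqrt r \in al.
    case: alP => _ ->; rewrite /singular_value sqrtr_ge0 sqr /=.
    by apply/eigenvalueP; exists v.
  have vp : in_plane (Num.sqrt r) v by apply/in_planeE; rewrite sqr.
  rewrite (bigD1_seq (Num.sqrt r)) ?al_uniq //= sv_proj_id // big_seq_cond big1 ?addr0 //.
  by move=> a /andP[aal ne]; apply: sv_proj_orth vp _; rewrite al_sqr.
have : (x <= \sum_(r <- rs) eigenspace (A^T *m A) r)%MS by rewrite rsP submx1.
elim: rs x {rsP} => [|r rs IH] x.
  by rewrite big_nil submx0 => /eqP ->; rewrite big1 // => a _; rewrite /sv_proj mul0mx.
rewrite big_cons => /sub_addsmxP[[c d] /= ->].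
rewrite {1}(xv r (c *m _)) ?submxMl // {1}(IH (d *m _)) ?submxMl // -big_split /=.
by apply: eq_bigr => a _; rewrite sv_projD.
Qed.

Lemma sv_proj_in_plane_sum (F : R -> 'rV[R]_m) a :
  (forall b, b \in al -> in_plane b (F b)) -> a \in al ->
  sv_proj A a (\sum_(b <- al) F b) = F a.
Proof.
move=> FP aal; rewrite sv_proj_sum (bigD1_seq a) ?al_uniq //= (sv_proj_id (FP _ aal)).
rewrite big_seq_cond big1 ?addr0 // => b /andP[bal ne].
by apply: sv_proj_orth (FP _ bal) _; rewrite al_sqr // eq_sym.
Qed.

Lemma in_plane_sum_eq0 (F : R -> 'rV[R]_m) : (forall a, a \in al -> in_plane a (F a)) ->
  \sum_(a <- al) F a = 0 -> forall a, a \in al -> F a = 0.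
Proof.
by move=> FP F0 a aal; rewrite -(sv_proj_in_plane_sum FP aal) F0 /sv_proj mul0mx.
Qed.

Lemma dot_in_plane_sum (F G : R -> 'rV[R]_m) :
  (forall a, a \in al -> in_plane a (F a)) -> (forall a, a \in al -> in_plane a (G a)) ->
  dot (\sum_(a <- al) F a) (\sum_(a <- al) G a) = \sum_(a <- al) dot (F a) (G a).
Proof.
move=> FP GP; rewrite dot_suml big_seq [RHS]big_seq; apply: eq_bigr => a aal.
rewrite dot_sumr (bigD1_seq a) ?al_uniq //= big_seq_cond big1 ?addr0 // => b /andP[bal ne].
by apply: in_plane_orth (FP _ aal) (GP _ bal) _; rewrite al_sqr // eq_sym.
Qed.

End SingularDecomposition.

(** * Geodesics *)

Section Derivatives.
Context {R : realType}.

Lemma is_derive_lin (f g : R -> R) (t df dg a b : R) :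
  is_derive t 1 f df -> is_derive t 1 g dg ->
  is_derive t 1 (fun s => a * f s + b * g s) (a * df + b * dg).
Proof.
move=> hf hg; have h1 := @is_deriveZ _ _ _ f a _ _ _ hf.
have h2 := @is_deriveZ _ _ _ g b _ _ _ hg; exact: (@is_deriveD _ _ _ _ _ _ _ _ _ h1 h2).
Qed.

Lemma is_derive_sum_seq (T : Type) (l : seq T) (F : T -> R -> R) (dF : T -> R) (t : R) :
  (forall a, is_derive t 1 (F a) (dF a)) ->
  is_derive t 1 (fun s => \sum_(a <- l) F a s) (\sum_(a <- l) dF a).
Proof.
move=> h; elim: l => [|a l IH].
  rewrite big_nil (_ : (fun _ => _) = cst 0); first exact: is_derive_cst.
  by apply/funext => s; rewrite big_nil.
rewrite big_cons (_ : (fun _ => _) = F a + (fun s => \sum_(b <- l) F b s)).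
  exact: is_deriveD.
by apply/funext => s; rewrite big_cons.
Qed.

(** The Hamiltonian is quadratic along lines, in the point as in the covector, so its directional
    derivatives can be read off as linear coefficients. *)
Lemma derive_quadratic (V : normedModType R) (f : V -> R) (a v : V) (L Q : R) :
  (forall h : R, f (h *: v + a) = f a + h * L + h ^+ 2 * Q) -> 'D_v f a = L.
Proof.
move=> fE; apply: cvg_lim => //.
have : (fun h : R => L + h * Q) @ 0^' --> L.
  have E : L + 0 * Q = L by rewrite mul0r addr0.
  rewrite -[X in _ --> X]E.
  apply: cvg_within_filter; apply: cvgD; first exact: cvg_cst.
  by apply: cvgMl; exact: cvg_id.
apply: cvg_trans; apply: near_eq_cvg; near=> h.
have h0 : h != 0 by near: h; exact: nbhs_dnbhs_neq.
rewrite /= fE (_ : _ - f a = h * (L + h * Q)); last by ring.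
by rewrite /GRing.scale /= mulrA mulVf // mul1r.
Unshelve. all: by end_near. Qed.

Context {m : nat}.

(** Tested against constant vectors, as Hamilton's equations are in [hamiltonian_curve]. *)
Definition vderive (X : R -> 'rV[R]_m) (t : R) (D : 'rV[R]_m) : Prop :=
  forall w, is_derive t 1 (fun s => dot (X s) w) (dot D w).

Lemma vderive_dot (X Y : R -> 'rV[R]_m) t DX DY : vderive X t DX -> vderive Y t DY ->
  is_derive t 1 (fun s => dot (X s) (Y s)) (dot DX (Y t) + dot (X t) DY).
Proof.
move=> hX hY.
have -> : dot DX (Y t) + dot (X t) DY =
    \sum_(i <- index_enum 'I_m) (X t ord0 i * DY ord0 i + Y t ord0 i * DX ord0 i).
  by rewrite addrC -big_split /=; apply: eq_bigr => i _; congr (_ + _); rewrite mulrC.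
apply: is_derive_sum_seq => i.
have coordd Z DZ : vderive Z t DZ -> is_derive t 1 (fun s => Z s ord0 i) (DZ ord0 i).
  move=> /(_ (delta_mx ord0 i)); rewrite dot_delta.
  by rewrite (_ : (fun s => dot (Z s) _) = (fun s => Z s ord0 i)) //; apply/funext => s; rewrite dot_delta.
have h := @is_deriveM _ _ _ _ _ _ _ _ (coordd _ _ hX) (coordd _ _ hY).
exact: is_derive_eq h _.
Qed.

Lemma vderive_lin (X Y : R -> 'rV[R]_m) t DX DY a b : vderive X t DX -> vderive Y t DY ->
  vderive (fun s => a *: X s + b *: Y s) t (a *: DX + b *: DY).
Proof.
move=> hX hY w; rewrite dotDl !dotZl; under eq_fun do rewrite dotDl !dotZl.
exact: is_derive_lin.
Qed.

Lemma vderive_mul (X : R -> 'rV[R]_m) t D M : vderive X t D ->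
  vderive (fun s => X s *m M) t (D *m M).
Proof.
move=> hX w; rewrite dot_mulmx; under eq_fun do rewrite dot_mulmx.
exact: hX.
Qed.

Lemma vderive_cst (X : 'rV[R]_m) t : vderive (fun=> X) t 0.
Proof. by move=> w; rewrite dot0l; exact: is_derive_cst. Qed.

Lemma vderive0_cst (X : R -> 'rV[R]_m) : (forall t, vderive X t 0) ->
  forall s, X s = X 0.
Proof.
move=> h s; apply/eqP; rewrite -subr_eq0; apply/eqP/dot_eq0.
have E w : dot (X s) w = dot (X 0) w.
  apply: (@is_derive_0_is_cst R (fun s => dot (X s) w)) => t.
  by have := h t w; rewrite dot0l.
by rewrite dotDl dotNl E subrr.
Qed.

End Derivatives.

(** * Momenta, their flow and the endpoint equations *)

Section Geodesics.
Context {R : realType} {n : nat} (G : contact_carnot R n).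
Local Notation A := (cc_A G).
Implicit Types (q xi zeta : ccpt R n) (x eta w : 'rV[R]_(n.*2)).

Lemma cc_A_skew : A^T = - A.
Proof.
have f00 : cc_f0 G != 0.
  apply/eqP => f00; have := cc_dim2 G; rewrite -cc_f0_gen f00.
  by rewrite dim_vline eqxx.
have brD (u v w : cc_lie G) : cc_br (u + v) w = cc_br u w + cc_br v w.
  by rewrite -[u in LHS]scale1r cc_br_linl scale1r.
have brDr (u v w : cc_lie G) : cc_br w (u + v) = cc_br w u + cc_br w v.
  by rewrite -[u in LHS]scale1r cc_br_linr scale1r.
apply/matrixP => i j; rewrite !mxE; apply/eqP; rewrite -addr_eq0.
have := cc_br_alt (cc_f G i + cc_f G j).
rewrite brD !brDr !cc_br_alt add0r addr0 !cc_AE -scalerDl addrC => /eqP.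
by rewrite scaler_eq0 (negbTE f00) orbF.
Qed.

Lemma pairingE xi q : pairing xi q = dot xi.1 q.1 + xi.2 * q.2.
Proof. by []. Qed.

(* The vector of the momenta [<xi, f_i>]. *)
Definition momenta q xi : 'rV[R]_(n.*2) := xi.1 + (xi.2 / 2) *: (q.1 *m A).

Lemma hamiltonianE q xi : hamiltonian G q xi = 2^-1 * dot (momenta q xi) (momenta q xi).
Proof.
rewrite /hamiltonian; congr (_ * _); apply: eq_bigr => i _.
rewrite -expr2 /cc_field linv_fieldE pairingE /=; congr (_ ^+ 2).
by rewrite dot_delta trmx_delta -colE /momenta !mxE add0r mulrA.
Qed.

Lemma derive_hamiltonian_momentum q xi zeta :
  'D_zeta (hamiltonian G q) xi = dot (momenta q xi) (momenta q zeta).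
Proof.
apply: (@derive_quadratic _ _ _ _ _ _ (hamiltonian G q zeta)) => h.
rewrite !hamiltonianE (_ : momenta q (h *: zeta + xi) = h *: momenta q zeta + momenta q xi).
  move: (momenta q zeta) (momenta q xi) => u v.
  by rewrite !(dotDl, dotDr, dotZl, dotZr) (dotC u v); field.
rewrite /momenta /= scalerDr scalerA addrACA; congr (_ + _).
by rewrite -scalerDl /GRing.scale /= mulrDl mulrA.
Qed.

Lemma derive_hamiltonian_point q xi v :
  'D_v (fun q => hamiltonian G q xi) q = xi.2 / 2 * dot (momenta q xi) (v.1 *m A).
Proof.
apply: (@derive_quadratic _ _ _ _ _ _ ((xi.2 / 2) ^+ 2 * dot (v.1 *m A) (v.1 *m A) / 2)) => h.
rewrite !hamiltonianE.
rewrite (_ : momenta (h *: v + q) xi = (xi.2 / 2 * h) *: (v.1 *m A) + momenta q xi).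
  move: (v.1 *m A) (momenta q xi) => u w.
  by rewrite !(dotDl, dotDr, dotZl, dotZr) (dotC u w); field.
by rewrite /momenta /= mulmxDl scalerDr -scalemxAl scalerA addrCA.
Qed.

Section Flow.
Context (al : seq R).
Hypothesis alP : distinct_singular_values A al.

(** This is [eta exp (c s A)]: on the plane of [a] one has [A^2 = - a^2], so the exponential series
    sums to a cosine and a sine. *)
Definition flow eta (c s : R) : 'rV[R]_(n.*2) :=
  \sum_(a <- al) (cos (c * a * s) *: sv_proj A a eta +
                  (sin (c * a * s) / a) *: (sv_proj A a eta *m A)).

Lemma flow0 eta c : flow eta c 0 = eta.
Proof.
rewrite [RHS](sv_decomp cc_A_skew (cc_contact G) alP); apply: eq_bigr => a _.
by rewrite mulr0 cos0 sin0 mul0r scale0r addr0 scale1r.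
Qed.

Lemma flow_derive eta c t : vderive (flow eta c) t (c *: (flow eta c t *m A)).
Proof.
move=> w; rewrite dotZl dot_mulmx dot_suml mulr_sumr.
under eq_fun do rewrite dot_suml.
rewrite (eq_big_seq (fun a : R => dot (sv_proj A a eta) w * (- (c * a * sin (c * a * t))) +
    dot (sv_proj A a eta *m A) w / a * (c * a * cos (c * a * t)))); last first.
  move=> a aal.
  have a0 : a != 0 by rewrite gt_eqF // (al_gt0 cc_A_skew (cc_contact G) alP).
  rewrite -dot_mulmx mulmxDl dotDl -!scalemxAl (sv_proj_in cc_A_skew a eta) !dotZl dotNl dotZl.
  by field.
apply: is_derive_sum_seq => a.
rewrite (_ : (fun s => dot _ w) = fun s => dot (sv_proj A a eta) w * cos (c * a * s) +
    dot (sv_proj A a eta *m A) w / a * sin (c * a * s)); last first.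
  by apply/funext => s; rewrite dotDl !dotZl; ring.
by apply: is_derive_lin; [exact: is_derive_cos_scale | exact: is_derive_sin_scale].
Qed.

Lemma vderive_energy (X : R -> 'rV[R]_(n.*2)) (c : R) :
  (forall t, vderive X t (c *: (X t *m A))) -> forall s, dot (X s) (X s) = dot (X 0) (X 0).
Proof.
move=> hX s; apply: (@is_derive_0_is_cst R (fun s => dot (X s) (X s))) => t.
apply: is_derive_eq (vderive_dot (hX t) (hX t)) _.
by rewrite dotC -mulr2n dotZr (dot_skew0 cc_A_skew) mulr0 mul0rn.
Qed.

Lemma flow_energy eta c s : dot (flow eta c s) (flow eta c s) = dot eta eta.
Proof. by rewrite (vderive_energy (flow_derive eta c)) flow0. Qed.

(* A linear equation with skew-symmetric coefficient preserves the norm, which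
   gives uniqueness of its solutions. *)
Lemma flow_unique (X : R -> 'rV[R]_(n.*2)) (c : R) :
  (forall t, vderive X t (c *: (X t *m A))) -> forall s, X s = flow (X 0) c s.
Proof.
move=> hX s; pose D s := X s - flow (X 0) c s.
have hD t : vderive D t (c *: (D t *m A)).
  have := vderive_lin 1 (-1) (hX t) (flow_derive (X 0) c t).
  rewrite scale1r scaleN1r -scalerBr -mulmxBl /vderive => h w.
  have := h w; congr (is_derive _ _ _ _).
  by apply/funext => r; rewrite scale1r scaleN1r.
apply/eqP; rewrite -subr_eq0; apply/eqP/dot_eq0; rewrite -/(D s) (vderive_energy hD).
by rewrite /D flow0 subrr dot0l.
Qed.

Definition reaches (p : ccpt R n) eta (c : R) : Prop :=
  flow eta c 1 = eta + c *: (p.1 *m A) /\ 2 * c * p.2 = dot eta eta - dot eta p.1.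

(** The Hamiltonian does not depend on [z], so the last momentum keeps its value [c]; then
    [h - c x A] is conserved, and so is [2 c z + <eta, x> - |eta|^2 s]. Their values at times 0 and
    1 give the two equations. *)
Lemma geodesics_reaches p eta c : geodesics_to G p (eta, c) -> reaches p eta c.
Proof.
case=> lam lamP [lam0 lam1].
pose x s := (lam s).1.1; pose z s := (lam s).1.2; pose xi s := (lam s).2.1.
have cE s : (lam s).2.2 = c.
  have -> : c = (lam 0).2.2 by rewrite lam0.
  apply: (@is_derive_0_is_cst R (fun s => (lam s).2.2)) => t.
  have [_ /(_ (0, 1))] := lamP t.
  rewrite derive_hamiltonian_point /= mul0mx dot0r mulr0 oppr0.
  by congr (is_derive _ _ _ _); apply/funext => r; rewrite pairingE /= dot0r add0r mulr1.
pose h s := momenta (lam s).1 (lam s).2.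
have dx t : vderive x t (h t).
  move=> w; have [/(_ (w, 0)) + _] := lamP t.
  rewrite derive_hamiltonian_momentum /= {2}/momenta /= mul0r scale0r addr0.
  by congr (is_derive _ _ _ _); apply/funext => r; rewrite pairingE /= mul0r addr0 dotC.
have dz (t : R) : is_derive t (1 : R) z (2^-1 * dot (h t) (x t *m A)).
  have [/(_ (0, 1)) + _] := lamP t.
  rewrite derive_hamiltonian_momentum /= {2}/momenta /= add0r dotZr mul1r.
  by congr (is_derive _ _ _ _); apply/funext => r; rewrite pairingE /= dot0l add0r mul1r.
have dxi t : vderive xi t ((c / 2) *: (h t *m A)).
  move=> w; have [_ /(_ (w, 0))] := lamP t.
  rewrite derive_hamiltonian_point /= cE dotZl (dot_skew cc_A_skew) mulrN.
  by congr (is_derive _ _ _ _); apply/funext => r; rewrite pairingE /= mulr0 addr0.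
have xiE s : xi s = eta + (c / 2) *: (x s *m A).
  have d0 t : vderive (fun s => 1 *: xi s + (- (c / 2)) *: (x s *m A)) t 0.
    have := vderive_lin 1 (- (c / 2)) (dxi t) (vderive_mul A (dx t)).
    by rewrite scale1r -scalerDl subrr scale0r.
  have := vderive0_cst d0 s; rewrite !scale1r /xi /x lam0 /= mul0mx scaler0 addr0 => <-.
  by rewrite scaleNr subrK.
have hE s : h s = eta + c *: (x s *m A).
  rewrite /h /momenta cE -/(xi s) -/(x s) xiE -addrA -scalerDl.
  by congr (_ + _ *: _); field.
have dh t : vderive h t (c *: (h t *m A)).
  have := vderive_lin 1 c (vderive_cst eta t) (vderive_mul A (dx t)).
  rewrite scaler0 add0r => H w; have := H w.
  by congr (is_derive _ _ _ _); apply/funext => r; rewrite hE scale1r.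
have h0 : h 0 = eta by rewrite hE /x lam0 mul0mx scaler0 addr0.
have xp : x 1 = p.1 by rewrite /x lam1.
split; first by rewrite -xp -hE (flow_unique dh) h0.
pose g s := 2 * c * z s + dot eta (x s).
have dg (t : R) : is_derive t (1 : R) (fun s => 1 * g s + (- dot eta eta) * s) 0.
  have d1 : is_derive t (1 : R) g (2 * c * (2^-1 * dot (h t) (x t *m A)) + dot eta (h t)).
    have := is_derive_lin (2 * c) 1 (dz t) (dx t eta).
    rewrite mul1r (dotC (h t) eta); congr (is_derive _ _ _ _).
    by apply/funext => r; rewrite /g mul1r (dotC eta).
  have := is_derive_lin 1 (- dot eta eta) d1 (is_derive_id t (1 : R)).
  congr (is_derive _ _ _ _).
  have : dot (h t) (h t) = dot eta eta by rewrite (vderive_energy dh) h0.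
  have : dot (h t) (c *: (x t *m A)) = dot (h t) (h t) - dot (h t) eta.
    have -> : c *: (x t *m A) = h t - eta by rewrite hE addrAC subrr add0r.
    by rewrite dotDr dotNr.
  rewrite dotZr => e1 e2; rewrite (dotC eta (h t)); lra.
have := @is_derive_0_is_cst R _ 1 0 dg.
rewrite /g /z /x lam1 lam0 /= dot0r !mulr0 addr0 !mul1r !mulr1 => e.
by rewrite -[LHS](addrK (dot eta p.1)); lra.
Qed.

(** For [c <> 0] the position is recovered algebraically from the momenta, as
    [x = (h - eta) A^-1 / c], and [z] from the conserved quantity, without integrating the
    equations. *)
Lemma reaches_geodesics p eta c : c != 0 -> reaches p eta c -> geodesics_to G p (eta, c).
Proof.
move=> c0 [p1E p2E]; have Au := cc_contact G.
pose x s := c^-1 *: ((flow eta c s - eta) *m invmx A).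
pose z s := (dot eta eta * s - dot eta (x s)) / (2 * c).
pose xi s := 2^-1 *: eta + 2^-1 *: flow eta c s.
have xA s : c *: (x s *m A) = flow eta c s - eta.
  by rewrite -scalemxAl mulmxKV // scalerA mulfV // scale1r.
have dx t : vderive x t (flow eta c t).
  have H := vderive_mul (invmx A) (vderive_lin 1 (-1) (flow_derive eta c t) (vderive_cst eta t)).
  have := vderive_lin c^-1 0 H (vderive_cst 0 t).
  rewrite !scaler0 !addr0 scale1r -scalemxAl mulmxK // scalerA mulVf // scale1r => H' w.
  have := H' w; congr (is_derive _ _ _ _); apply/funext => r.
  by rewrite ?scale0r addr0 scale1r scaleN1r.
have dz (t : R) : is_derive t (1 : R) z ((dot eta eta - dot eta (flow eta c t)) / (2 * c)).
  have := is_derive_lin (dot eta eta / (2 * c)) (- (2 * c)^-1) (is_derive_id t (1 : R)) (dx t eta).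
  rewrite mulr1 (_ : _ + _ = (dot eta eta - dot eta (flow eta c t)) / (2 * c)); last first.
    by rewrite (dotC eta); ring.
  congr (is_derive _ _ _ _); apply/funext => r; rewrite /z (dotC eta (x r)); ring.
have dxi t : vderive xi t ((c / 2) *: (flow eta c t *m A)).
  have := vderive_lin 2^-1 2^-1 (vderive_cst eta t) (flow_derive eta c t).
  by rewrite scaler0 add0r scalerA mulrC.
exists (fun s => ((x s, z s), (xi s, c))); last first.
  split; rewrite /z /x /xi.
    rewrite flow0 subrr mul0mx scaler0 dot0r mulr0 subr0 mul0r -scalerDl.
    by rewrite (_ : 2^-1 + 2^-1 = 1) ?scale1r //; field.
  rewrite /= p1E addrAC subrr add0r -scalemxAl mulmxK // scalerA mulVf // scale1r.
  by rewrite mulr1 -p2E [2 * c * _]mulrC mulfK ?mulf_neq0 // -surjective_pairing.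
move=> t; have mE zeta : momenta (x t, z t) zeta = zeta.1 + (zeta.2 / 2) *: (x t *m A) by [].
have hE : momenta (x t, z t) (xi t, c) = flow eta c t.
  rewrite mE /= /xi; have -> : c / 2 = 2^-1 * c by ring.
  rewrite -scalerA xA scalerBr [X in X + _]addrC addrACA subrr addr0 -scalerDl.
  by rewrite (_ : 2^-1 + 2^-1 = 1) ?scale1r //; field.
split=> [zeta|v] /=.
  rewrite derive_hamiltonian_momentum hE mE dotDr dotZr.
  have := is_derive_lin 1 zeta.2 (dx t zeta.1) (dz t).
  rewrite (_ : 1 * _ + _ = dot (flow eta c t) zeta.1 +
      zeta.2 / 2 * dot (flow eta c t) (x t *m A)); last first.
    rewrite mul1r; congr (_ + _).
    have : dot (flow eta c t) (c *: (x t *m A)) = dot eta eta - dot eta (flow eta c t).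
      by rewrite xA dotDr dotNr flow_energy (dotC _ eta).
    by rewrite dotZr => <-; field.
  congr (is_derive _ _ _ _); apply/funext => r; rewrite pairingE /= mul1r dotC //.
rewrite derive_hamiltonian_point hE /=.
have := is_derive_lin 1 1 (dxi t v.1) (is_derive_cst (c * v.2) t (1 : R)).
rewrite mulr0 addr0 mul1r dotZl (dot_skew cc_A_skew) mulrN.
by congr (is_derive _ _ _ _); apply/funext => r; rewrite pairingE /= !mul1r.
Qed.

End Flow.
End Geodesics.

(** * Solutions of [F(zeta) = z] *)

Section Solutions.
Context {R : realType}.
Implicit Types (bs : seq R) (b p q v : R).

Lemma sin_le_id (x : R) : 0 <= x -> sin x <= x.
Proof.
move=> x0; pose g (s : R) := s - sin s.
have dg (s : R) : is_derive s 1 g (1 - cos s) by apply: is_deriveB.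
have cg : {within `[0, x], continuous g}.
  by apply: derivable_within_continuous => s _; exact: (@ex_derive _ _ _ _ _ _ _ (dg s)).
have [c _ gE] := MVT_segment x0 (fun s _ => dg s) cg.
rewrite -subr_ge0 -/(g x); have -> : g x = g x - g 0 by rewrite /g sin0 !subr0.
by rewrite gE subr0 mulr_ge0 // subr_ge0 cos_le1.
Qed.

Lemma poleP bs p : reflect (pole bs p) (has (fun b => sin (b * p * pi) == 0) bs).
Proof.
apply: (iffP hasP) => -[b bbs].
  move=> /eqP s0; exists b => //; exists (Num.floor (b * p)).
  set r := b * p - (Num.floor (b * p))%:~R.
  have r0 : 0 <= r by rewrite subr_ge0 floor_le.
  have r1 : r < 1 by rewrite ltrBlDl -[1]/(1%:~R) -intrD floorD1_gt.
  apply/eqP; rewrite mulrC -subr_eq0 -/r; apply: contraT => rn0.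
  have : 0 < sin (r * pi).
    apply: sin_gt0_pi; have p0 := @pi_gt0 R; have rp : 0 < r by rewrite lt_neqAle eq_sym rn0.
    by rewrite mulr_gt0 // gtr_pMl.
  have : sin (r * pi) ^+ 2 = 0.
    rewrite -(sin_int_shift _ (Num.floor (b * p))) -mulrDl subrK s0 expr0n //.
  by move=> /eqP; rewrite sqrf_eq0 => /eqP ->; rewrite ltxx.
case=> m mE; exists b => //; rewrite mulrC in mE.
have := sin_int_shift (0 : R) m; rewrite add0r sin0 expr0n -mE => /eqP.
by rewrite sqrf_eq0.
Qed.

Lemma pole_opp bs p : pole bs p -> pole bs (- p).
Proof. by case=> b bbs [m mE]; exists b => //; exists (- m); rewrite mulNr mE intrN. Qed.

Lemma next_pole bs v : bs != [::] -> (forall b, b \in bs -> 0 < b) ->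
  exists2 q, pole bs q & v < q /\ forall p, pole bs p -> p <= v \/ q <= p.
Proof.
move=> bs0 bsP; have one b : 0 < b -> exists2 q, (exists m : int, q * b = m%:~R) &
    v < q /\ forall p, (exists m : int, p * b = m%:~R) -> p <= v \/ q <= p.
  move=> b0; exists ((Num.floor (v * b) + 1)%:~R / b).
    by exists (Num.floor (v * b) + 1); rewrite divfK ?gt_eqF.
  split=> [|p [m mE]]; first by rewrite ltr_pdivlMr // floorD1_gt.
  have [pv|vp] := leP p v; [by left | right].
  by rewrite ler_pdivrMr // mE ler_int lezD1 floor_lt_int -mE ltr_pM2r.
elim: bs bs0 bsP => // b bs IH _ bsP.
have [q [m mE] [vq qP]] := one _ (bsP b (mem_head _ _)).
have [bs0|bs0] := eqVneq bs [::].
  exists q; first by exists b; [exact: mem_head | exists m].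
  by split=> // p [b']; rewrite bs0 inE => /eqP -> /qP.
have bsP' b' : b' \in bs -> 0 < b' by move=> h; apply: bsP; rewrite inE h orbT.
have [q' [b' b'bs q'b'] [vq' qP']] := IH bs0 bsP'.
have [qq|qq] := leP q q'.
  exists q; first by exists b; [exact: mem_head | exists m].
  split=> // p [b2]; rewrite inE => /orP[/eqP -> /qP //|b2bs h].
  have pp : pole bs p by exists b2.
  by have [h1|h1] := qP' p pp; [left | right; exact: le_trans qq h1].
exists q'; first by exists b' => //; rewrite inE b'bs orbT.
split=> // p [b2]; rewrite inE => /orP[/eqP -> /qP[h|h]|b2bs h]; first by left.
  by right; apply: le_trans (ltW qq) h.
by apply: qP'; exists b2.
Qed.

Lemma prev_pole bs v : bs != [::] -> (forall b, b \in bs -> 0 < b) ->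
  exists2 q, pole bs q & q < v /\ forall p, pole bs p -> p <= q \/ v <= p.
Proof.
move=> bs0 bsP; have [q pq [vq qP]] := @next_pole bs (- v) bs0 bsP.
exists (- q); first exact: pole_opp.
split=> [|p /pole_opp/qP[h|h]]; first by rewrite ltrNl.
  by right; rewrite -lerN2.
by left; rewrite lerNr.
Qed.

(** The poles of one frequency are discrete: ending the interval at the next one removes them all,
    one frequency at a time. *)
Lemma nonresonant_between (al : seq R) (l r : R) : l < r -> (forall a, a \in al -> 0 < a) ->
  exists2 w, l < w < r & ~ pole al w.
Proof.
elim: al l r => [|a al IH] l r lr alP.
  by exists ((l + r) / 2); [lra | case].
have a0 := alP a (mem_head _ _).
have [s [ls sr sP]] : exists s, [/\ l < s, s <= r &
    forall p m, l < p -> p < s -> p * a = m%:~R -> False].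
  exists (Num.min r ((Num.floor (l * a) + 1)%:~R / a)); split.
  - by rewrite lt_min lr ltr_pdivlMr // floorD1_gt.
  - by rewrite ge_min lexx.
  move=> p m lp; rewrite lt_min ltr_pdivlMr // => /andP[_ +] mE.
  rewrite mE ltr_int ltzD1 floor_ge_int -mE leNgt ltr_pM2r // lp //.
have [b bal|w /andP[lw ws] wN] := IH l s ls; first by apply: alP; rewrite inE bal orbT.
exists w; first by rewrite lw (lt_le_trans ws).
case=> b; rewrite inE => /orP[/eqP -> [m]|bal h]; first exact: sP lw ws.
by apply: wN; exists b.
Qed.

Section Weights.
Variables (bs : seq R) (y : R -> R).
Hypotheses (bs_n0 : bs != [::]) (bsP : forall b, b \in bs -> 0 < b)
  (yP : forall b, b \in bs -> 0 < y b).

(* The function [F] in the variable [u = zeta / (2 pi)]; at a pole the term is 0. *)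
Definition Phi_term b u : R :=
  y b * (b / 8) * (2 * pi * u * b - sin (2 * pi * u * b)) / sin (b * u * pi) ^+ 2.

Definition Phi (u : R) : R := \sum_(b <- bs) Phi_term b u.

Lemma Phi_term_ge0 b u : b \in bs -> 0 <= u -> 0 <= Phi_term b u.
Proof.
move=> bbs u0; have b0 := ltW (bsP bbs); have y0 := ltW (yP bbs); have p0 := @pi_ge0 R.
rewrite /Phi_term divr_ge0 ?sqr_ge0 // !mulr_ge0 // ?divr_ge0 // subr_ge0 sin_le_id //.
by rewrite !mulr_ge0.
Qed.

Lemma sin_scale_continuous (k : R) : continuous (fun u : R => sin (k * u)).
Proof.
move=> u; apply: (@continuous_comp _ _ _ (fun u => k * u) sin); last exact: continuous_sin.
exact: mulrl_continuous.
Qed.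

Lemma Phi_term_continuous b u : sin (b * u * pi) != 0 -> {for u, continuous (Phi_term b)}.
Proof.
move=> s0.
have -> : Phi_term b = (fun u => y b * (b / 8) * ((2 * pi * b) * u - sin ((2 * pi * b) * u)) *
    (sin ((b * pi) * u) * sin ((b * pi) * u))^-1).
  by apply/funext => r; rewrite /Phi_term expr2 (mulrAC _ r b) (mulrAC b r pi).
apply: continuousM.
  apply: continuousM; first exact: cst_continuous.
  by apply: continuousB; [exact: mulrl_continuous | exact: sin_scale_continuous].
apply: continuousV; first by rewrite (mulrAC b pi u) mulf_neq0.
by apply: continuousM; exact: sin_scale_continuous.
Qed.

Lemma Phi_continuous u : ~ pole bs u -> {for u, continuous Phi}.
Proof.
move=> up; have sn b : b \in bs -> sin (b * u * pi) != 0.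
  by move=> bbs; apply/negP => s0; apply: up; apply/poleP/hasP; exists b.
have -> : Phi = (fun u => \sum_(b <- bs) Phi_term b u) by [].
elim: (bs) sn => [_|b l IH sn].
  rewrite (_ : (fun _ => _) = cst 0); first exact: cst_continuous.
  by apply/funext => r; rewrite big_nil.
rewrite (_ : (fun _ => _) = (fun r => Phi_term b r + \sum_(b <- l) Phi_term b r)).
  apply: continuousD; first by apply: Phi_term_continuous; rewrite sn ?mem_head.
  by apply: IH => b' b'l; rewrite sn // inE b'l orbT.
by apply/funext => r; rewrite big_cons.
Qed.

(** At a positive pole [q b >= 1], so nearby the numerator [2 pi t b - sin (2 pi t b)] is at least 1
    while the squared sine below it tends to 0. The other terms are nonnegative. *)
Lemma Phi_near_pole q (Z : R) : pole bs q -> 0 < q -> 0 < Z ->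
  exists2 d, 0 < d & forall t, `|t - q| < d -> ~ pole bs t -> Z < Phi t.
Proof.
move=> [b bbs [m mE]] q0 Z0; have b0 := bsP bbs; have y0 := yP bbs; have p2 := @pi_ge2 R.
pose kap := y b * b / (8 * Z); have kap0 : 0 < kap by rewrite divr_gt0 ?mulr_gt0.
have m1 : 1 <= m%:~R :> R.
  have : 0 < m%:~R :> R by rewrite -mE mulr_gt0.
  by rewrite ltr0z -[1 <= _]/(1%:~R <= _) ler_int.
have sq : sin (b * pi * q) * sin (b * pi * q) = 0.
  have /hasP[b' _ _] : has (fun b => sin (b * q * pi) == 0) bs.
    by apply/poleP; exists b => //; exists m.
  have : has (fun b => sin (b * q * pi) == 0) [:: b].
    by apply/poleP; exists b; [exact: mem_head | exists m].
  by rewrite /= orbF => /eqP; rewrite (mulrAC b q pi) => ->; rewrite mul0r.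
have cs : {for q, continuous (fun t => sin (b * pi * t) * sin (b * pi * t))}.
  by apply: continuousM; exact: sin_scale_continuous.
have /cvgrPdist_lt /(_ kap kap0) := cs.
rewrite sq => /nbhs_ballP[e /= e0 eP].
exists (Num.min e (q / 2)); first by rewrite lt_min e0 divr_gt0.
move=> t; rewrite lt_min => /andP[te tq] tN.
have qt : q / 2 <= t by move: tq; rewrite ltr_norml; lra.
have t0 : 0 <= t by move: qt q0; lra.
have sn : sin (b * t * pi) != 0.
  by apply/negP => s0; apply: tN; apply/poleP/hasP; exists b.
have s2 : sin (b * t * pi) ^+ 2 < kap.
  have := eP t; rewrite /ball /= distrC => /(_ te).
  by rewrite sub0r normrN -expr2 ger0_norm ?sqr_ge0 // (mulrAC b pi t).
apply: (@lt_le_trans _ _ (Phi_term b t)); last first.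
  rewrite /Phi (big_rem b) //= lerDl big_seq sumr_ge0 // => b' /mem_rem b'bs.
  exact: Phi_term_ge0.
rewrite /Phi_term ltr_pdivlMr ?exprn_even_gt0 //.
apply: (@lt_le_trans _ _ (y b * (b / 8))).
  by move: s2; rewrite /kap ltr_pdivlMr ?mulr_gt0 //; lra.
apply: ler_peMr; first by apply: mulr_ge0; [exact: ltW | apply: divr_ge0 => //; exact: ltW].
rewrite lerBrDr.
have : 1 <= 2 * pi * t * b - 1.
  have h1 : 1 / 2 <= t * b.
    apply: (@le_trans _ _ (q / 2 * b)); last by rewrite ler_pM2r.
    by rewrite mulrAC mE ler_pM2r ?invr_gt0.
  by rewrite -[2 * pi * t * b]mulrA; nra.
by have := sin_le1 (2 * pi * t * b); lra.
Qed.

(* On both sides of a point where [Phi < Z], the function blows up at the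
   nearest pole, hence takes the value [Z]. *)
Lemma Phi_two_solutions (al : seq R) (v Z : R) : (forall a, a \in al -> 0 < a) ->
  ~ pole bs v -> (exists2 p, pole bs p & 0 < p < v) -> Phi v < Z -> 0 < Z ->
  exists tl w tr, [/\ [/\ 0 < tl, tl < w, w < tr & tl <= v <= tr],
    Phi tl = Z, Phi tr = Z, Phi w < Z /\ ~ pole al w &
    forall p, tl <= p <= tr -> ~ pole bs p].
Proof.
move=> alP vN [p0 pp0 /andP[p00 p0v]] vZ Z0.
have [ql pql [qlv qlP]] := prev_pole v bs_n0 bsP.
have [qr pqr [vqr qrP]] := next_pole v bs_n0 bsP.
have ql0 : 0 < ql.
  have [h|h] := qlP _ pp0; first exact: lt_le_trans h.
  by move: h; rewrite leNgt p0v.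
have noP p : ql < p < qr -> ~ pole bs p.
  move=> /andP[h1 h2] pp; have [h3|h3] := qlP _ pp.
    by move: h3; rewrite leNgt h1.
  have [h4|h4] := qrP _ pp; last by move: h4; rewrite leNgt h2.
  by apply: vN; rewrite (_ : v = p) //; apply/eqP; rewrite eq_le h3 h4.
have [dl dl0 dlP] := Phi_near_pole pql ql0 Z0.
have [dr dr0 drP] := Phi_near_pole pqr (lt_trans (lt_trans ql0 qlv) vqr) Z0.
have [sl [h1 h2 h3]] : exists s, [/\ ql < s, s < v & Z < Phi s].
  exists (Num.min (ql + dl / 2) ((ql + v) / 2)).
  have hlt : ql < Num.min (ql + dl / 2) ((ql + v) / 2) by rewrite lt_min; lra.
  have hv : Num.min (ql + dl / 2) ((ql + v) / 2) < v by rewrite gt_min; lra.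
  split => //; apply: dlP.
    rewrite ger0_norm ?subr_ge0 ?ltW // ltrBlDl gt_min; lra.
  by apply: noP; rewrite hlt (lt_trans hv).
have [sr [h4 h5 h6]] : exists s, [/\ v < s, s < qr & Z < Phi s].
  exists (Num.max (qr - dr / 2) ((qr + v) / 2)).
  have hlt : v < Num.max (qr - dr / 2) ((qr + v) / 2) by rewrite lt_max; lra.
  have hv : Num.max (qr - dr / 2) ((qr + v) / 2) < qr by rewrite gt_max; lra.
  split => //; apply: drP.
    rewrite distrC ger0_norm ?subr_ge0 ?ltW // ltrBlDl -ltrBlDr lt_max; lra.
  by apply: noP; rewrite hv (lt_trans qlv).
have cont c1 c2 : ql < c1 -> c2 < qr -> {within `[c1, c2], continuous Phi}.
  move=> hc1 hc2; apply: continuous_in_subspaceT => u.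
  rewrite inE /= in_itv /= => /andP[u1 u2]; apply: Phi_continuous; apply: noP.
  by rewrite (lt_le_trans hc1 u1) (le_lt_trans u2 hc2).
have [|tl] := IVT (ltW h2) (cont _ _ h1 vqr) (v := Z).
  by rewrite ge_min le_max (ltW h3) (ltW vZ) orbT.
rewrite in_itv /= => /andP[tl1 tl2] tlE.
have [|tr] := IVT (ltW h4) (cont _ _ qlv h5) (v := Z).
  by rewrite ge_min le_max (ltW h6) (ltW vZ) orbT.
rewrite in_itv /= => /andP[tr1 tr2] trE.
have tlv : tl < v.
  by rewrite lt_neqAle tl2 andbT; apply/eqP => e; move: vZ; rewrite -e tlE ltxx.
have vtr : v < tr.
  by rewrite lt_neqAle tr1 andbT; apply/eqP => e; move: vZ; rewrite e trE ltxx.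
(* [w] stays close to [v], where [Phi < Z] persists, but avoids the resonances of all of [al]: at a
   resonance of a plane where [x] vanishes, the component of the covector there would be free and
   the height would not determine [z]. *)
have /cvgrPdist_lt /(_ (Z - Phi v)) := Phi_continuous vN.
rewrite subr_gt0 => /(_ vZ) /nbhs_ballP[e /= e0 eP].
have vm : v < Num.min (v + e) tr by rewrite lt_min vtr ltrDl e0.
have [w /andP[w1 w2] wN] := nonresonant_between vm alP.
move: w2; rewrite lt_min => /andP[we wtr].
exists tl, w, tr; split => //.
- split => //; first by rewrite (lt_trans ql0) // (lt_le_trans h1).
    exact: lt_trans w1.
  by rewrite !ltW.
- split => //; have hw : ball v e w.
    by rewrite /ball /= distrC ger0_norm ?subr_ge0 ?ltW // ltrBlDl.
  by have := eP w hw; rewrite /= ltr_norml; lra.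
move=> p /andP[hp1 hp2]; apply: noP.
by rewrite (lt_le_trans h1) ?(le_trans tl1) //= (le_lt_trans hp2) // (le_lt_trans tr2).
Qed.

End Weights.
End Solutions.

(** * Solving the endpoint equations plane by plane *)

Section Fibre.
Context {R : realType} {n : nat} (G : contact_carnot R n) (al : seq R).
Hypothesis alP : distinct_singular_values (cc_A G) al.
Local Notation A := (cc_A G).
Local Notation pr := (sv_proj A).
Let skew := cc_A_skew G.
Let Au := cc_contact G.
Implicit Types (x eta : 'rV[R]_(n.*2)) (c a : R).

Definition height x c : R :=
  \sum_(a <- al) dot (pr a x) (pr a x) * (a / 8) * (c * a - sin (c * a)) /
    sin (c * a / 2) ^+ 2.

(** The solution of the equation in [reaches_plane], an equation whose determinant on the plane is
    [4 sin^2 (c a / 2)]. *)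
Definition covector_part x c a : 'rV[R]_(n.*2) :=
  (c * a / 2 * (cos (c * a / 2) / sin (c * a / 2))) *: pr a x - (c / 2) *: (pr a x *m A).

Lemma covector_part_in x c a : in_plane A a (covector_part x c a).
Proof.
rewrite /covector_part -scaleNr; apply: in_planeD; apply: in_planeZ.
  exact: sv_proj_in.
by apply: in_plane_mul; exact: sv_proj_in.
Qed.

Lemma covector_part_mul x c a : covector_part x c a *m A =
  (c * a / 2 * (cos (c * a / 2) / sin (c * a / 2))) *: (pr a x *m A) +
  (c / 2 * a ^+ 2) *: pr a x.
Proof.
by rewrite mulmxBl -!scalemxAl (sv_proj_in skew a x) scalerN opprK scalerA.
Qed.

Lemma sin_double (t : R) : sin t = 2 * (sin (t / 2) * cos (t / 2)).
Proof.
rewrite {1}(_ : t = t / 2 *+ 2) ?sin_mulr2n ?mulr2n; first by ring.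
by field.
Qed.

Lemma cos_double (t : R) : cos t = 1 - 2 * sin (t / 2) ^+ 2.
Proof.
rewrite {1}(_ : t = t / 2 *+ 2) ?cos_mulr2n ?cos2sin2 ?mulr2n; first by ring.
by field.
Qed.

Lemma mul_decomp x : x *m A = \sum_(a <- al) pr a x *m A.
Proof. by rewrite {1}(sv_decomp skew Au alP x) mulmx_suml. Qed.

Definition regular x c : Prop :=
  forall a, a \in al -> pr a x != 0 -> sin (c * a / 2) != 0.

Lemma covector_height x c (eta := \sum_(a <- al) covector_part x c a) :
  regular x c -> dot eta eta - dot eta x = 2 * c * height x c.
Proof.
move=> reg; have -> : dot eta x = dot eta (\sum_(a <- al) pr a x).
  by rewrite -(sv_decomp skew Au alP).
rewrite /eta.
have cin a : a \in al -> in_plane A a (covector_part x c a).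
  by move=> _; exact: covector_part_in.
have pin a : a \in al -> in_plane A a (pr a x) by move=> _; exact: sv_proj_in.
rewrite (dot_in_plane_sum skew Au alP cin cin) (dot_in_plane_sum skew Au alP cin pin).
rewrite -sumrB /height mulr_sumr; apply: eq_big_seq => a aal.
have [x0|x0] := eqVneq (pr a x) 0.
  by rewrite /covector_part x0 mul0mx !scaler0 subr0 !dot0l !mul0r mulr0 subr0.
have s0 := reg a aal x0.
rewrite /covector_part !(dotDl, dotDr, dotNl, dotNr, dotZl, dotZr).
rewrite (in_plane_dot_mul skew (sv_proj_in skew a x)) (dotC (pr a x *m A)).
rewrite (dot_skew0 skew).
rewrite (sin_double (c * a)); have := cos2sin2 (c * a / 2).
move: (dot _ _) (sin _) (cos _) s0 => d s k s0 ks.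
apply/eqP; rewrite -subr_eq0 (_ : _ - _ = d * (c * a) ^+ 2 / 4 / s ^+ 2 * (k ^+ 2 - (1 - s ^+ 2))).
  by rewrite ks subrr mulr0.
by field.
Qed.

(** In the planes where [x] vanishes the covector is given the component 0, so only the resonances
    of the other planes have to be avoided. *)
Lemma regular_reaches x z c : c != 0 -> regular x c -> height x c = z ->
  exists eta, reaches G al (x, z) eta c.
Proof.
move=> c0 reg hz; exists (\sum_(a <- al) covector_part x c a).
split; last by rewrite /= covector_height // hz.
rewrite /= mul_decomp scaler_sumr -big_split /=.
apply: eq_big_seq => a aal; have a0 : a != 0 by rewrite gt_eqF // (al_gt0 skew Au alP).
have cin b : b \in al -> in_plane A b (covector_part x c b).
  by move=> _; exact: covector_part_in.
rewrite (sv_proj_in_plane_sum skew Au alP cin aal) covector_part_mul /covector_part.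
have [x0|x0] := eqVneq (pr a x) 0.
  by rewrite x0 mul0mx !scaler0 !addr0 subr0 !scaler0 addr0.
have s0 := reg a aal x0; rewrite mulr1 (cos_double (c * a)) (sin_double (c * a)).
have := cos2sin2 (c * a / 2); move: (sin _) (cos _) s0 => s k s0 ks.
apply/rowP => i; move: (pr a x) (pr a x *m A) => X Y; rewrite !mxE.
move: (X _ _) (Y _ _) => X1 Y1; apply/eqP; rewrite -subr_eq0.
rewrite (_ : _ - _ = c * Y1 * (k ^+ 2 - (1 - s ^+ 2))); first by rewrite ks subrr mulr0.
by field; rewrite ?a0 ?s0.
Qed.

Lemma reaches_plane x z eta c a : reaches G al (x, z) eta c -> a \in al ->
  (cos (c * a) - 1) *: pr a eta + (sin (c * a) / a) *: (pr a eta *m A) = c *: (pr a x *m A).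
Proof.
move=> [h _] aal; apply/eqP; rewrite -subr_eq0; apply/eqP.
pose F a := (cos (c * a) - 1) *: pr a eta + (sin (c * a) / a) *: (pr a eta *m A)
  - c *: (pr a x *m A).
apply: (@in_plane_sum_eq0 _ _ A al skew Au alP F _ _ a aal) => [b _|].
  rewrite /F -scaleNr; apply: in_planeD; first apply: in_planeD; apply: in_planeZ;
    rewrite ?/in_plane; try apply: in_plane_mul; exact: sv_proj_in.
move: h; rewrite /= mul_decomp [X in _ = X + _](sv_decomp skew Au alP eta) scaler_sumr.
rewrite -big_split /= => /eqP; rewrite -subr_eq0 -sumrB => /eqP h.
rewrite -[RHS]h.
apply: eq_bigr => b _; rewrite /F mulr1 scalerBl scale1r opprD addrA.
by congr (_ - _); rewrite addrAC.
Qed.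

(** At a resonance the flow is the identity on the plane of [a], and the endpoint equation forces
    [c x_a A = 0], hence [x_a = 0]. *)
Lemma reaches_regular x z eta c : c != 0 -> reaches G al (x, z) eta c -> regular x c.
Proof.
move=> c0 h a aal; apply: contra => /eqP s0; have := reaches_plane h aal.
rewrite (cos_double (c * a)) (sin_double (c * a)) s0 expr0n /= mulr0 subr0 subrr scale0r !mul0r mulr0 mul0r.
rewrite scale0r addr0 => /esym/eqP; rewrite scaler_eq0 (negbTE c0) /= => /eqP xA.
by rewrite -[pr a x](mulmxK Au) xA mul0mx.
Qed.

Lemma reaches_height x z eta c : c != 0 -> reaches G al (x, z) eta c ->
  (forall a, a \in al -> sin (c * a / 2) != 0) -> z = height x c.
Proof.
move=> c0 h reg; have [_ /= h2] := h.
have etaE : eta = \sum_(a <- al) covector_part x c a.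
  rewrite [LHS](sv_decomp skew Au alP); apply: eq_big_seq => a aal.
  have s0 := reg a aal; have a0 : a != 0 by rewrite gt_eqF // (al_gt0 skew Au alP).
  have e1 := reaches_plane h aal.
  (* The equation and its image under [A] form a linear system in [eta] and [eta A]; [E3] is
     Cramer's rule, with determinant [4 s^2]. *)
  have := congr1 (mulmx^~ A) e1; rewrite mulmxDl -!scalemxAl.
  rewrite (sv_proj_in skew a eta) (sv_proj_in skew a x) /covector_part.
  move: e1; rewrite (cos_double (c * a)) (sin_double (c * a)); have := cos2sin2 (c * a / 2).
  move: (sin _) (cos _) (pr a x) (pr a eta) (pr a x *m A) (pr a eta *m A) s0.
  move=> s k X H Y K s0 ks /rowP e1 /rowP e2.
  apply/rowP => i; have := e1 i; have := e2 i; rewrite !mxE.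
  move: (X _ _) (Y _ _) (H _ _) (K _ _) => X1 Y1 H1 K1 E2 E1.
  have s20 : 4 * s ^+ 2 != 0 by rewrite mulf_neq0 // expf_neq0.
  have E3 : 4 * s ^+ 2 * H1 = - (2 * s ^+ 2) * (c * Y1) -
      2 * (s * k) / a * (c * - (a ^+ 2 * X1)).
    rewrite -E1 -E2; apply/eqP; rewrite -subr_eq0.
    rewrite (_ : _ - _ = - 4 * s ^+ 2 * H1 * (k ^+ 2 - (1 - s ^+ 2))).
      by rewrite ks subrr mulr0.
    by field; rewrite ?a0 ?s0.
  by apply: (mulfI s20); rewrite E3; field; rewrite ?a0 ?s0.
apply: (@mulfI _ (2 * c)); first by rewrite mulf_neq0.
rewrite h2 etaE covector_height // => a aal _; exact: reg.
Qed.

End Fibre.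

(** * Lower bounds *)

Section Betti.
Context {R : realType} {n : nat} (G : contact_carnot R n) (al : seq R).
Hypothesis alP : distinct_singular_values (cc_A G) al.
Local Notation A := (cc_A G).
Local Notation pr := (sv_proj A).
Let skew := cc_A_skew G.
Let Au := cc_contact G.
Implicit Types (x eta : 'rV[R]_(n.*2)) (c a : R) (p : ccpt R n).

(** The last coordinate of the covector is a continuous function on the fibre and serves to separate
    its points. *)
Lemma betahat_ge p (I : finType) (t : I -> R) :
  (forall i, exists eta, geodesics_to G p (eta, t i)) ->
  (forall i j, i != j -> exists2 s, (forall eta, ~ geodesics_to G p (eta, s)) &
    t i < s < t j \/ t j < s < t i) ->
  (#|I|%:R%:E <= betahat G p)%E.
Proof.
move=> tP sep; pose T : topologicalType := geodesics_to G p.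
have /choice[e eP] : forall i, exists eta, geodesics_to G p (eta, t i) by [].
pose f i : T := exist _ (e i, t i) (mem_set (eP i)).
apply: (@total_betti_ge R T (fun y => (\val y).2) I f).
  move=> y; apply: (@continuous_comp _ _ _ (\val : T -> ccpt R n) snd).
    exact: initial_continuous.
  exact: cvg_snd.
move=> i j /sep[s sN hs]; exists s => // -[[eta c] h] /= cs.
by apply: (sN eta); rewrite -cs; exact: set_mem h.
Qed.

Lemma heightN x c : height G al x (- c) = - height G al x c.
Proof.
rewrite /height -sumrN; apply: eq_bigr => a _.
by rewrite !mulNr sinN (sinN (_ / 2)) sqrrN; ring.
Qed.

Lemma height_sg x c (z : R) : z != 0 -> height G al x (Num.sg z * c) = Num.sg z * height G al x c.
Proof.
move=> z0; have [zn|zp|/eqP] := ltgtP z 0; last by rewrite (negbTE z0).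
  by rewrite ltr0_sg // !mulN1r heightN.
by rewrite gtr0_sg // !mul1r.
Qed.

Lemma height0 c : height G al 0 c = 0.
Proof. by rewrite /height big1 // => a _; rewrite /sv_proj mul0mx dot0l !mul0r. Qed.

Lemma sin_sg_sqr (z t : R) : z != 0 -> (sin (Num.sg z * t) == 0) = (sin t == 0).
Proof. by move=> z0; rewrite sin_sg mulf_eq0 sgr_eq0 (negbTE z0). Qed.

Lemma between_sg (z u s v : R) : z != 0 -> u < s < v \/ v < s < u ->
  let f r := Num.sg z * (2 * pi * r) in f u < f s < f v \/ f v < f s < f u.
Proof.
move=> z0 h f; have p0 : 0 < 2 * pi :> R by rewrite mulr_gt0 // pi_gt0.
have [zn|zp|/eqP] := ltgtP z 0; last by rewrite (negbTE z0).
  by rewrite /f ltr0_sg // !mulN1r !ltrN2 !ltr_pM2l //; case: h => /andP[-> ->]; [right|left].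
by rewrite /f gtr0_sg // !mul1r !ltr_pM2l.
Qed.

Definition active x : seq R := [seq a <- al | pr a x != 0].

Definition weight x a : R := dot (pr a x) (pr a x).

Lemma height_Phi x (u : R) : height G al x (2 * pi * u) = Phi (active x) (weight x) u.
Proof.
rewrite /height /Phi big_filter [RHS]big_mkcond; apply: eq_bigr => a _.
have -> : 2 * pi * u * a / 2 = a * u * pi by move: (pi) => c; field.
rewrite /Phi_term /weight; case: ifPn => // /negPn/eqP ->.
by rewrite dot0l !mul0r.
Qed.

Lemma active_gt0 x b : b \in active x -> 0 < b.
Proof. by rewrite mem_filter => /andP[_ /(al_gt0 skew Au alP)]. Qed.

Lemma weight_gt0 x b : b \in active x -> 0 < weight x b.
Proof.
rewrite mem_filter => /andP[x0 _]; rewrite lt_neqAle dot_ge0 andbT eq_sym.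
by apply: contra x0 => /eqP/dot_eq0 ->.
Qed.

Lemma sum_weight x : \sum_(b <- active x) weight x b = enorm x ^+ 2.
Proof.
rewrite -dot_enorm.
have -> : dot x x = dot (\sum_(a <- al) pr a x) (\sum_(a <- al) pr a x).
  by rewrite -(sv_decomp skew Au alP).
have pin a : a \in al -> in_plane A a (pr a x) by move=> _; exact: sv_proj_in.
rewrite (dot_in_plane_sum skew Au alP pin pin) big_filter big_mkcond.
by apply: eq_bigr => a _; case: ifPn => // /negPn/eqP ->; rewrite dot0l.
Qed.

Lemma active_neq0 x : x != 0 -> active x != [::].
Proof.
move=> x0; apply/eqP => h; have := sum_weight x; rewrite h big_nil -dot_enorm => /esym.
by move/dot_eq0/eqP; rewrite (negbTE x0).
Qed.

Lemma betahat_good_points x (z K beta Q : R) : x != 0 -> z != 0 -> 0 < beta ->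
  good_points_bound K (active x) beta Q ->
  ((8 / pi * (Q / beta ^+ 2) * (`|z| / enorm x ^+ 2) - 2 * K)%:E <= betahat G (x, z))%E.
Proof.
move=> x0 z0 beta0 H; set bs := active x in H; have p0 := @pi_gt0 R.
have e0 : 0 < enorm x ^+ 2.
  rewrite -dot_enorm lt_neqAle dot_ge0 andbT eq_sym.
  by apply: contra x0 => /eqP/dot_eq0 ->.
have Z0 : 0 < `|z| by rewrite normr_gt0.
pose T := 8 * `|z| / (enorm x ^+ 2 * beta ^+ 2).
have T0 : 0 <= T by apply: divr_ge0; apply: mulr_ge0 => //; exact: sqr_ge0.
have [I [v [cI vpos vP vsep]]] := H T T0.
have bs0 : bs != [::] by exact: active_neq0.
have bsP b : b \in bs -> 0 < b by exact: active_gt0.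
have yP b : b \in bs -> 0 < weight x b by exact: weight_gt0.
have vgt0 i : 0 < v i by have [p _ /andP[h1 h2]] := vpos i; exact: lt_trans h2.
have bT : beta ^+ 2 * T = 8 * `|z| / enorm x ^+ 2.
  rewrite /T; have := lt0r_neq0 e0; move: (enorm x ^+ 2) => d d0.
  by field; rewrite d0 gt_eqF.
have vnp i : ~ pole bs (v i).
  move=> /poleP/hasP[b bbs /eqP s0]; have := vP i b bbs; rewrite s0 expr0n mulr0.
  have b0 := bsP _ bbs; rewrite ltNge => /negP; apply; apply: mulr_ge0; first exact: ltW.
  by rewrite addr_ge0 // !mulr_ge0 // ltW.
(* [|z|] is distributed over the planes in proportion to [|x_a|^2], and each term of [Phi] is
   compared with its share. *)
have Phiv i : Phi bs (weight x) (v i) < `|z|.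
  have -> : `|z| = \sum_(b <- bs) weight x b / 8 * (8 * `|z| / enorm x ^+ 2).
    rewrite -mulr_suml -mulr_suml sum_weight; have := lt0r_neq0 e0.
    by move: (enorm x ^+ 2) => d d0; field; rewrite d0.
  rewrite /Phi; case: (bs) bs0 bsP yP vP vnp => // b0 l _ bsP yP vP vnp.
  rewrite big_seq [ltRHS]big_seq; apply: ltr_sum.
    by apply/hasP; exists b0; rewrite ?mem_index_enum ?mem_head.
  move=> b bbs; have b_0 := bsP _ bbs; have y0 := yP _ bbs.
  have s0 : 0 < sin (b * v i * pi) ^+ 2.
    rewrite exprn_even_gt0 //=; apply/negP => s0; apply: (vnp i).
    by apply/poleP/hasP; exists b.
  have y8 : 0 < weight x b / 8 by rewrite divr_gt0.
  rewrite /Phi_term ltr_pdivrMr // -bT -[ltRHS]mulrA.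
  rewrite (_ : weight x b * (b / 8) = weight x b / 8 * b); last by ring.
  rewrite -mulrA ltr_pM2l //; apply: le_lt_trans (vP i b bbs).
  by rewrite ler_pM2l // lerD2l; have := sin_geN1 (2 * pi * v i * b); lra.
have /choice[tl /choice[w /choice[tr solP]]] : forall i, exists tl w tr : R,
   [/\ [/\ 0 < tl, tl < w, w < tr & tl <= v i <= tr],
    Phi bs (weight x) tl = `|z|, Phi bs (weight x) tr = `|z|,
    Phi bs (weight x) w < `|z| /\ ~ pole al w &
    forall q, tl <= q <= tr -> ~ pole bs q].
  move=> i; apply: Phi_two_solutions => //.
  by move=> a; exact: (al_gt0 skew Au alP).
pose sol (ib : I * bool) := if ib.2 then tr ib.1 else tl ib.1.
have sgn0 : Num.sg z != 0 by rewrite sgr_eq0.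
have sgE u a : Num.sg z * (2 * pi * u) * a / 2 = Num.sg z * (a * u * pi).
  by move: (pi) => c; field.
have pole_reg u : 0 < u -> ~ pole bs u -> regular G al x (Num.sg z * (2 * pi * u)).
  move=> u0 un a aal xa; rewrite sgE sin_sg_sqr //.
  by apply/negP => s0; apply: un; apply/poleP/hasP; exists a; rewrite ?mem_filter ?xa.
have solQ ib : 0 < sol ib /\ ~ pole bs (sol ib) /\ Phi bs (weight x) (sol ib) = `|z|.
  case: ib => i b; have [[h1 h2 h3 /andP[h4 h5]] h6 h7 _ h8] := solP i.
  rewrite /sol; case: b => /=; do !split => //; try apply: h8.
  - exact: lt_trans (lt_trans h1 h2) h3.
  - by rewrite lexx (le_trans h4).
  - by rewrite lexx (le_trans h4).
have c_n0 u : 0 < u -> Num.sg z * (2 * pi * u) != 0.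
  by move=> u0; rewrite mulf_neq0 // !mulf_neq0 // gt_eqF.
have noPole q eta : 0 < q -> pole bs q -> ~ geodesics_to G (x, z) (eta, Num.sg z * (2 * pi * q)).
  move=> q0 /poleP/hasP[b bbs s0] /(geodesics_reaches alP)/(reaches_regular alP (c_n0 _ q0)).
  move=> /(_ b); move: bbs; rewrite mem_filter => /andP[xb bal] /(_ bal xb).
  by rewrite sgE sin_sg_sqr // s0.
have noW i eta : ~ geodesics_to G (x, z) (eta, Num.sg z * (2 * pi * w i)).
  have [[h1 h2 h3 _] _ _ [h6 h7] _] := solP i; have w0 := lt_trans h1 h2.
  move=> /(geodesics_reaches alP)/(reaches_height alP (c_n0 _ w0)) hz.
  have : z = Num.sg z * Phi bs (weight x) (w i).
    rewrite -height_Phi -height_sg //; apply: hz => a aal.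
    rewrite sgE sin_sg_sqr //.
    by apply/negP => s0; apply: h7; apply/poleP/hasP; exists a.
  rewrite {1}[z]numEsg => /(mulfI sgn0) e.
  by move: h6; rewrite -e ltxx.
have -> : 8 / pi * (Q / beta ^+ 2) * (`|z| / enorm x ^+ 2) - 2 * K = 2 * (Q * T / (2 * pi) - K).
  rewrite /T; have := gt_eqF p0; have := gt_eqF e0; have := gt_eqF beta0.
  move: (pi) (enorm x ^+ 2) => c d h1 h2 h3; field; by rewrite h1 h2 h3.
apply: (@le_trans _ _ (#|{: I * bool}|%:R%:E)).
  by rewrite lee_fin card_prod card_bool natrM mulrC ler_pM2r.
apply: (@betahat_ge (x, z) _ (fun ib => Num.sg z * (2 * pi * sol ib))) => [ib|].
  have [h1 [h2 h3]] := solQ ib.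
  have [|eta he] := @regular_reaches _ _ G al alP x z _ (c_n0 _ h1) (pole_reg _ h1 h2).
    by rewrite height_sg // height_Phi h3 -numEsg.
  by exists eta; exact: (reaches_geodesics alP (c_n0 _ h1) he).
move=> [i b] [j b'] ne; have [ij|ij] := eqVneq i j.
  have {ne} : b != b' by apply: contra ne => /eqP ->; rewrite ij.
  rewrite -ij => bb'; exists (Num.sg z * (2 * pi * w i)); first exact: noW.
  have [[h1 h2 h3 _] _ _ _ _] := solP i.
  apply: between_sg => //; rewrite /sol /=.
  by case: b b' bb' => [] [] //= _; rewrite h2 h3; [right | left].
have [q pq hq] := vsep _ _ ij.
have [[a1 a2 a3 /andP[a4 a5]] _ _ _ a6] := solP i.
have [[b1 b2 b3 /andP[b4 b5]] _ _ _ b6] := solP j.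
have q0 : 0 < q by case: hq => /andP[hq _]; exact: lt_trans (vgt0 _) hq.
exists (Num.sg z * (2 * pi * q)); first by move=> eta; exact: noPole.
(* The interval from [tl k] to [tr k] contains no pole, so a pole between two good points separates
   their intervals, and with them the solutions. *)
have out k (t1 t2 : R) : t1 <= v k <= t2 -> (forall r, t1 <= r <= t2 -> ~ pole bs r) ->
    (v k < q -> t2 < q) /\ (q < v k -> q < t1).
  move=> /andP[c1 c2] hN; split=> hk; rewrite ltNge; apply/negP => hk'.
    by apply: (hN q) => //; rewrite hk' (le_trans c1) // ltW.
  by apply: (hN q) => //; rewrite hk' (le_trans _ c2) // ltW.
have [i1 i2] := out i (tl i) (tr i) (introT andP (conj a4 a5)) a6.
have [j1 j2] := out j (tl j) (tr j) (introT andP (conj b4 b5)) b6.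
have inI k (c : bool) : tl k < w k -> w k < tr k -> tl k <= sol (k, c) <= tr k.
  by move=> k1 k2; have k3 := ltW (lt_trans k1 k2); rewrite /sol; case: c => /=; rewrite lexx k3.
have /andP[si1 si2] := inI i b a2 a3; have /andP[sj1 sj2] := inI j b' b2 b3.
apply: between_sg => //; case: hq => /andP[q1 q2]; [left | right].
  by rewrite (le_lt_trans si2 (i1 q1)) (lt_le_trans (j2 q2) sj1).
by rewrite (le_lt_trans sj2 (j1 q1)) (lt_le_trans (i2 q2) si1).
Qed.

Lemma dim_gt0 : (0 < n)%N.
Proof.
rewrite lt0n; apply/eqP => n0; have := cc_dim2 G; rewrite -cc_br11.
have -> : vbasis (cc_g1 G) = [::] :> seq _.
  by apply: size0nil; rewrite size_tuple cc_dim1 n0.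
by rewrite /= span_nil dimv0.
Qed.

Lemma al_neq0 : al != [::].
Proof.
apply/eqP => al0; have dim2 : (0 < n.*2)%N by rewrite double_gt0 dim_gt0.
have := sv_decomp skew Au alP (delta_mx ord0 (Ordinal dim2)).
rewrite al0 big_nil => /rowP/(_ (Ordinal dim2)); rewrite !mxE !eqxx => /eqP.
by rewrite oner_eq0.
Qed.

(* Over the center, each multiple of [2 pi / a] carries a nonempty sphere of covectors. *)
Lemma betahat_center (z : R) : z != 0 -> betahat G (0, z) = +oo%E.
Proof.
move=> z0; have p0 := @pi_gt0 R.
have aal : al`_0 \in al by have := al_neq0; case: (al) => //= a l _; rewrite mem_head.
set a := al`_0 in aal; have a0 := al_gt0 skew Au alP aal.
have [w wP wn0] : exists2 w, in_plane A a w & w != 0.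
  case: (alP) => _ /(_ a); rewrite aal => /esym/andP[_ /eigenvalueP[w wE w0]].
  by exists w => //; apply/in_planeE.
have ww : 0 < dot w w.
  by rewrite lt_neqAle dot_ge0 andbT eq_sym; apply: contra wn0 => /eqP/dot_eq0 ->.
have c_n0 (u : R) : 0 < u -> Num.sg z * (2 * pi * u) != 0.
  by move=> u0; rewrite mulf_neq0 ?sgr_eq0 // !mulf_neq0 // gt_eqF.
(* At this [c] the flow is the identity on the plane of [a], so every covector in it returns to the
   center; its length is fixed by [|eta|^2 = 2 c z], positive because [c] has the sign of [z]. *)
have sol (m : nat) : exists eta, geodesics_to G (0, z) (eta, Num.sg z * (2 * pi * (m.+1%:R / a))).
  set c := Num.sg z * _.
  have u0 : 0 < m.+1%:R / a by rewrite divr_gt0.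
  have cz : 0 < 2 * c * z.
    rewrite (_ : 2 * c * z = 2 * (2 * pi * (m.+1%:R / a)) * (Num.sg z * z)); last first.
      by rewrite /c; ring.
    rewrite -normrEsg; apply: mulr_gt0; last by rewrite normr_gt0.
    by apply: mulr_gt0 => //; apply: mulr_gt0 => //; apply: mulr_gt0.
  exists (Num.sqrt (2 * c * z / dot w w) *: w); apply: (reaches_geodesics alP (c_n0 _ u0)).
  set eta := _ *: w; have ein : in_plane A a eta by exact: in_planeZ.
  split => /=; last first.
    rewrite dot0r subr0 dotZl dotZr mulrA -expr2 sqr_sqrtr ?divfK ?gt_eqF //.
    by rewrite divr_ge0 // ltW.
  rewrite mul0mx scaler0 addr0 /flow (bigD1_seq a) ?(al_uniq alP) //= big_seq_cond.
  rewrite big1 ?addr0 => [|b /andP[bal ne]]; last first.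
    have -> : pr b eta = 0.
      by apply: (sv_proj_orth skew ein); rewrite (al_sqr skew Au alP).
    by rewrite mul0mx !scaler0 addr0.
  rewrite (sv_proj_id skew ein) mulr1.
  have hs : sin (c * a / 2) = 0.
    have := sin_int_shift (0 : R) (Posz m.+1); rewrite add0r sin0 expr0n /= => /eqP.
    rewrite sqrf_eq0 => /eqP s0.
    have -> : c * a / 2 = Num.sg z * (m.+1%:R * pi).
      by rewrite /c; move: (pi) (m.+1%:R : R) => r q; field; rewrite gt_eqF.
    by rewrite sin_sg s0 mulr0.
  rewrite (cos_double (c * a)) (sin_double (c * a)) hs expr0n /= mulr0 subr0 mul0r mulr0 mul0r.
  by rewrite scale0r addr0 scale1r.
(* Off all resonances the height over [x = 0] is 0, which differs from [z]. *)
have sep (u v : R) : 0 < u -> u < v -> exists2 s, u < s < v &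
    forall eta, ~ geodesics_to G (0, z) (eta, Num.sg z * (2 * pi * s)).
  move=> u0 uv; have [s us sN] := nonresonant_between uv (fun b h => al_gt0 skew Au alP h).
  exists s => // eta /(geodesics_reaches alP) h.
  have s0 : 0 < s by case/andP: us => us _; exact: lt_trans us.
  have := reaches_height alP (c_n0 _ s0) h.
  rewrite height0 => hz; apply: (elimN eqP z0); apply: hz => b bal.
  have -> : Num.sg z * (2 * pi * s) * b / 2 = Num.sg z * (b * s * pi).
    by move: (pi) => r; field.
  by rewrite sin_sg_sqr //; apply/negP => hs; apply: sN; apply/poleP/hasP; exists b.
apply: eq_infty => r; set N := (Num.truncn r).+1.
apply: (@le_trans _ _ (#|'I_N|%:R%:E)).
  by rewrite card_ord lee_fin ltW // truncnS_gt.
apply: (@betahat_ge (0, z) _ (fun i : 'I_N => Num.sg z * (2 * pi * (i.+1%:R / a)))) => //.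
have lt_t (i j : 'I_N) : (i < j)%N -> i.+1%:R / a < j.+1%:R / a.
  by move=> ij; rewrite ltr_pM2r ?invr_gt0 // ltr_nat ltnS.
have pos (i : 'I_N) : 0 < i.+1%:R / a by rewrite divr_gt0.
move=> i j ne; have [ij|ij|ij] := ltngtP i j; last by case/eqP: ne; exact: val_inj.
  have [s hs sN] := sep _ _ (pos i) (lt_t _ _ ij).
  by exists (Num.sg z * (2 * pi * s)) => //; apply: between_sg => //; left.
have [s hs sN] := sep _ _ (pos j) (lt_t _ _ ij).
by exists (Num.sg z * (2 * pi * s)) => //; apply: between_sg => //; right.
Qed.

End Betti.

(** * The constants and their homogeneity *)

Section Constants.
Context {R : realType}.
Implicit Types (al bl : seq R).

(** The masks run over the possible sets of active frequencies; the factor 2 comes from the two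
    geodesics per good point. *)
Definition error_term bl : R :=
  - (2 * \sum_(J : (size bl).-tuple bool) gap_const (mask J bl)).

Definition normalise al : seq R := [seq a / al`_0 | a <- al].

(* Normalising gives degree 0, and summing over all masks removes the dependence on
   the set of indices with [x_j = 0]. *)
Definition R1_const al : R := error_term (normalise al).

(** [delta'] is replaced by the inverse of the number of singular values, a lower bound for it
    whatever [I_0] is. The result is positive and depends on the singular values alone. *)
Definition C1_const al : R :=
  8 / pi * (al`_0 / al`_(size al).-1 ^+ 2) * sin ((size al)%:R^-1 * pi / 2) ^+ 2.

Lemma error_term_le0 bl : error_term bl <= 0.
Proof. by rewrite oppr_le0 mulr_ge0 // sumr_ge0 // => J _; exact: gap_const_ge0. Qed.

Lemma error_term_mask bl (s : seq bool) : size s = size bl ->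
  error_term bl <= - (2 * gap_const (mask s bl)).
Proof.
move=> /eqP sz; rewrite lerN2 ler_pM2l // (bigD1 (Tuple sz)) //= lerDl sumr_ge0 // => J _.
exact: gap_const_ge0.
Qed.

Lemma normalise_scale (l : R) al : l != 0 -> al != [::] ->
  normalise [seq l * a | a <- al] = normalise al.
Proof.
move=> l0; case: al => // b al _; rewrite /normalise -map_comp; apply: eq_map => a /=.
by rewrite -mulf_div divff // mul1r.
Qed.

Lemma homogeneous_R1 : homogeneous 0 R1_const.
Proof.
move=> al l [al0 _ _] l0; rewrite expr0z mul1r /R1_const normalise_scale // gt_eqF //.
Qed.

Lemma scale_ratio (l : R) al : l != 0 -> al != [::] ->
  [seq l * a | a <- al]`_0 / [seq l * a | a <- al]`_(size al).-1 ^+ 2 =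
  l^-1 * (al`_0 / al`_(size al).-1 ^+ 2).
Proof.
move=> l0; case: al => // b al _; rewrite !(nth_map 0) //= exprMn invfM.
by move: (nth _ _ _ ^- 2) => Y; field.
Qed.

Lemma homogeneous_C1 : homogeneous (-1) C1_const.
Proof.
move=> al l [al0 _ _] l0; rewrite /C1_const size_map scale_ratio ?gt_eqF //.
by rewrite exprN1; ring.
Qed.

Lemma homogeneous_C1' (I : pred nat) : homogeneous (-1) (fun al => C1' al I).
Proof.
move=> al l [al0 _ _] l0; have ln0 : l != 0 by rewrite gt_eqF.
rewrite /C1' size_map scale_ratio //.
have -> : delta' [seq l * a | a <- al] I = delta' al I.
  rewrite /delta' size_map; congr (_^-1); rewrite big_nat_cond [RHS]big_nat_cond.
  apply: eq_bigr => j /andP[/andP[_ jn] _].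
  have sz0 : (0 < size al)%N := leq_ltn_trans (leq0n _) jn.
  by rewrite !(nth_map 0) // -!mulf_div divff // !mul1r.
by rewrite exprN1; ring.
Qed.

Lemma C1_gt0 al : admissible al -> 0 < C1_const al.
Proof.
move=> [al0 _ alP]; have p0 := @pi_gt0 R; have sz : (0 < size al)%N by rewrite lt0n size_eq0.
have h1 : 0 < al`_0 by rewrite alP // mem_nth.
have h2 : 0 < al`_(size al).-1 by rewrite alP // mem_nth // ltn_predL.
have sz1 : 1 <= (size al)%:R :> R by rewrite ler1n.
have i1 : (size al)%:R^-1 <= 1 :> R by rewrite invf_le1 // ltr0n.
have i0 : 0 < (size al)%:R^-1 :> R by rewrite invr_gt0 ltr0n.
rewrite /C1_const; apply: mulr_gt0; last first.
  rewrite exprn_gt0 // sin_gt0_pi //; apply/andP; split; first by rewrite !mulr_gt0.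
  have : (size al)%:R^-1 * pi <= 1 * pi :> R by rewrite ler_pM2r.
  by lra.
by apply: mulr_gt0; apply: divr_gt0 => //; exact: exprn_gt0.
Qed.

End Constants.

(** * Assembling the lower bounds *)

Section LowerBound.
Context {R : realType} {n : nat} (G : contact_carnot R n) (al : seq R).
Hypothesis alP : distinct_singular_values (cc_A G) al.
Local Notation A := (cc_A G).
Let skew := cc_A_skew G.
Let Au := cc_contact G.

Lemma al_head a : a \in al -> al`_0 <= a.
Proof.
case: alP => sal _; case: al sal => // b l; rewrite /= (path_sortedE lt_trans).
by case/andP => /allP h _; rewrite inE => /orP[/eqP -> //|/h/ltW].
Qed.

Lemma al0_gt0 : 0 < al`_0.
Proof. by apply: (al_gt0 skew Au alP); rewrite mem_nth // lt0n size_eq0 (al_neq0 alP). Qed.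

(** The normalised active frequencies are selected from [normalise al] by a mask, so their constant
    is one of the terms of [error_term]. Scaling back by the smallest singular value leaves that
    constant unchanged. *)
Lemma betahat_rate x (z : R) (bs := active G al x) : x != 0 ->
  ((8 / pi * (al`_0 * count_rate bs al`_0 / last 0 bs ^+ 2) * (`|z| / enorm x ^+ 2)
     + R1_const al)%:E <= betahat G (x, z))%E.
Proof.
move=> x0; have a0 := al0_gt0; have an0 : al`_0 != 0 by rewrite gt_eqF.
have [->|z0] := eqVneq z 0.
  rewrite normr0 mul0r mulr0 add0r; apply: (@le_trans _ _ 0%E).
    by rewrite lee_fin error_term_le0.
  exact: total_betti_ge0.
have bs0 : bs != [::] by exact: (active_neq0 alP).
have sal : sorted <%R al by case: alP.
have sbs : sorted <%R bs by apply: sorted_filter => //; exact: lt_trans.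
pose nbs := [seq a / al`_0 | a <- bs].
have nbsE : nbs = mask [seq sv_proj A a x != 0 | a <- al] (normalise al).
  by rewrite /nbs /normalise /bs /active filter_mask map_mask.
have bsE : bs = [seq al`_0 * a | a <- nbs].
  rewrite /nbs -map_comp -[LHS]map_id; apply: eq_map => a /=.
  by rewrite mulrC divfK.
have lastE : last 0 bs = al`_0 * last 0 nbs.
  by rewrite {1}bsE -{1}(mulr0 al`_0) last_map.
have KP : good_points_bound (gap_const nbs) nbs (last 0 nbs) (count_rate nbs 1).
  apply: gap_constP.
  - rewrite sorted_map; apply: sub_sorted sbs => a b /=.
    by rewrite ltr_pM2r // invr_gt0.
  - by rewrite -size_eq0 size_map size_eq0.
  - move=> _ /mapP[b bbs ->]; rewrite ler_pdivlMr // mul1r al_head //.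
    by move: bbs; rewrite mem_filter => /andP[].
have := good_points_scale a0 KP.
rewrite -bsE -lastE -(count_rate_scale 1 nbs an0) -bsE mulr1 => H.
have [lastbs _] := sorted_last sbs bs0.
have l0 : 0 < last 0 bs by apply: (active_gt0 alP lastbs).
apply: le_trans (betahat_good_points alP x0 z0 l0 H).
rewrite lee_fin lerD2l nbsE error_term_mask //.
by rewrite size_map /normalise size_map.
Qed.

Lemma lower_bound_rate (C : R) (p : ccpt R n) (bs := active G al p.1) : p <> 0 ->
  (p.1 != 0 -> C <= 8 / pi * (al`_0 * count_rate bs al`_0 / last 0 bs ^+ 2)) ->
  (lower_bound C (R1_const al) p <= betahat G p)%E.
Proof.
move=> p0 CP; rewrite /lower_bound; case: ifPn => [/eqP p10|p10].
  have p20 : p.2 != 0.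
    by apply/eqP => p20; apply: p0; rewrite [p]surjective_pairing p10 p20.
  by rewrite [p]surjective_pairing p10 (betahat_center alP p20).
have := betahat_rate p.2 p10; rewrite -surjective_pairing; apply: le_trans.
by rewrite lee_fin lerD2r ler_wpM2r ?CP // divr_ge0 ?sqr_ge0.
Qed.

(** The largest active frequency is at most [alpha_k], so putting [alpha_k] in the denominator only
    lowers the constant. *)
Lemma rate_le (q : R) x (bs := active G al x) : x != 0 -> 0 <= q <= count_rate bs al`_0 ->
  8 / pi * (al`_0 / al`_(size al).-1 ^+ 2) * q <=
  8 / pi * (al`_0 * count_rate bs al`_0 / last 0 bs ^+ 2).
Proof.
move=> x0 /andP[q0 qr]; have a0 := al0_gt0; have p0 := @pi_gt0 R.
have bs0 : bs != [::] by exact: (active_neq0 alP).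
have sal : sorted <%R al by case: alP.
have sbs : sorted <%R bs by apply: sorted_filter => //; exact: lt_trans.
have [lastbs _] := sorted_last sbs bs0.
have [_ lastal] := sorted_last sal (al_neq0 alP).
have l0 : 0 < last 0 bs by apply: (active_gt0 alP lastbs).
have ll : last 0 bs <= al`_(size al).-1.
  by rewrite nth_last lastal //; move: lastbs; rewrite mem_filter => /andP[].
rewrite -mulrA ler_pM2l ?divr_gt0 // -!mulrA ler_pM2l // [leLHS]mulrC.
apply: ler_pM => //; first by rewrite invr_ge0 sqr_ge0.
by rewrite lef_pV2 ?posrE ?exprn_gt0 ?(lt_le_trans l0) // lerXn2r // nnegrE ltW ?(lt_le_trans l0).
Qed.

Lemma lower_bound_C1 (p : ccpt R n) : p <> 0 ->
  (lower_bound (C1_const al) (R1_const al) p <= betahat G p)%E.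
Proof.
move=> p0; apply: lower_bound_rate => // p10; apply: rate_le => //.
rewrite sqr_ge0 count_rate_ge ?al0_gt0 ?(active_neq0 alP) //.
  by move=> b; rewrite mem_filter => /andP[_ /al_head].
by rewrite size_filter count_size.
Qed.

(** With one active frequency the rate is 1 and dominates any squared sine; otherwise the sum in
    [count_rate] is that of [delta'], taken over values instead of indices. *)
Lemma lower_bound_C1' (p : ccpt R n) : p <> 0 ->
  (lower_bound (C1' al (I0 A al p.1)) (R1_const al) p <= betahat G p)%E.
Proof.
move=> p0; apply: lower_bound_rate => // p10; apply: rate_le => //.
rewrite sqr_ge0 /= /count_rate; case: ifP => _; first exact: sinsq_le1.
by rewrite /delta' /active big_filter [X in _ <= sin (X^-1 * _ / _) ^+ 2](big_nth 0).
Qed.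

End LowerBound.

Theorem theorem28 (R : realType) :
  exists R1 : seq R -> R,
  [/\ homogeneous 0 R1,
      (exists C1 : seq R -> R,
        [/\ homogeneous (-1) C1,
            (forall al : seq R, admissible al -> 0 < C1 al) &
            forall (n : nat) (G : contact_carnot R n) (al : seq R)
                (p : ccpt R n),
              distinct_singular_values (cc_A G) al -> p <> 0 ->
              (lower_bound (C1 al) (R1 al) p <= betahat G p)%E]),
      (forall I : pred nat, homogeneous (-1) (fun al : seq R => C1' al I)) &
      forall (n : nat) (G : contact_carnot R n) (al : seq R) (p : ccpt R n),
        distinct_singular_values (cc_A G) al -> p <> 0 ->
        (lower_bound (C1' al (I0 (cc_A G) al p.1)) (R1 al) p
          <= betahat G p)%E].
Proof.
exists R1_const; split.
- exact: homogeneous_R1.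
- exists C1_const; split; [exact: homogeneous_C1 | exact: C1_gt0 |].
  by move=> n G al p alP p0; exact: lower_bound_C1.
- exact: homogeneous_C1'.
- by move=> n G al p alP p0; exact: lower_bound_C1'.
Qed.
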